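(* There is a certifying algorithm that runs in time $O(|V|+|E|)$ to test whether an input split graph $G=(V,E)$ has a star $5$-coloring.
   Context: Graphs are finite, with no loops or parallel edges. A star coloring of $G$ is a proper vertex coloring in which no path on four vertices (as a not necessarily induced subgraph) uses only two colors; a star $k$-coloring is a star coloring using at most $k$ colors. A split graph is a graph whose vertex set can be partitioned into a clique $K$ and an independent set $S$. A recognition algorithm is certifying if, besides a yes/no answer, it returns a certificate allowing the user to verify the answer. Here a yes-certificate is a star $5$-coloring of $G$, and a no-certificate is an induced subgraph of $G$ isomorphic to one of $K_6,J_1,\dots,J_{12}$, where each $J_i$ is the split graph with clique $\{0,1,2,3,4\}$ and an independent set having exactly one vertex for each listed neighborhood: $J_1$: $\{0,1,2,3\},\{4\}$; $J_2$: $\{0,1,2,3\},\{0,4\}$; $J_3$: $\{0,1,2,3\},\{0,1,4\}$; $J_4$: $\{0,1,2,3\},\{0,1,2,4\}$; $J_5$: $\{0,1,2\},\{3,4\}$; $J_6$: $\{0,1,2\},\{2,3,4\}$; $J_7$: $\{0,1,2\},\{0,1,3\},\{0,2,3\},\{4\}$; $J_8$: $\{0,1,2\},\{0,1,3\},\{0,2,3\},\{0,4\}$; $J_9$: $\{0,1,2\},\{0,1,3\},\{2,3\},\{4\}$; $J_{10}$: $\{0,1,2\},\{0,1,3\},\{2,3\},\{0,4\}$; $J_{11}$: $\{0,1,2\},\{0,3\},\{2,3\},\{1,4\}$; $J_{12}$: $\{0,1\},\{0,2\},\{1,2\},\{3,4\}$. *)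

(* Defs.v *)
From mathcomp Require Import all_boot.

Set Implicit Arguments.
Unset Strict Implicit.
Unset Printing Implicit Defensive.

(* A graph on the finite type T is a symmetric irreflexive e : rel T. *)

Section Graphs.
Variables (T : finType) (e : rel T).

Definition clique (K : {set T}) : Prop :=
  {in K &, forall x y, x != y -> e x y}.

Definition independent (S : {set T}) : Prop :=
  {in S &, forall x y, ~~ e x y}.

Definition split_graph : Prop :=
  exists K : {set T}, clique K /\ independent (~: K).

Definition proper_coloring (k : nat) (f : T -> 'I_k) : Prop :=
  forall x y, e x y -> f x != f y.

(* The path a-b-c-d need not be induced. *)
Definition star_coloring (k : nat) (f : T -> 'I_k) : Prop :=
  proper_coloring f /\
  forall a b c d, uniq [:: a; b; c; d] -> e a b -> e b c -> e c d ->
    2 < #|f @: [set a; b; c; d]|.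

Definition star_colorable (k : nat) : Prop :=
  exists f : T -> 'I_k, star_coloring f.

Definition induced (W : {set T}) : rel {x : T | x \in W} :=
  fun x y => e (val x) (val y).

End Graphs.

Definition isomorphic (T U : finType) (e : rel T) (d : rel U) : Prop :=
  exists f : T -> U, bijective f /\ forall x y, d (f x) (f y) = e x y.

Definition complete (n : nat) : rel 'I_n := fun x y => x != y.

(* The split graph with clique {0, 1, 2, 3, 4}, and with one further vertex   *)
(* 5 + i, of neighborhood N`_i, for each i < size N.                          *)
Definition split5 (N : seq (seq nat)) : rel 'I_(5 + size N) :=
  fun x y =>
    if x < 5 then
      if y < 5 then x != y else nat_of_ord x \in nth [::] N (y - 5)
    else (y < 5) && (nat_of_ord y \in nth [::] N (x - 5)).

Definition J_nbhds : seq (seq (seq nat)) :=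
  [:: [:: [:: 0; 1; 2; 3]; [:: 4]];
      [:: [:: 0; 1; 2; 3]; [:: 0; 4]];
      [:: [:: 0; 1; 2; 3]; [:: 0; 1; 4]];
      [:: [:: 0; 1; 2; 3]; [:: 0; 1; 2; 4]];
      [:: [:: 0; 1; 2]; [:: 3; 4]];
      [:: [:: 0; 1; 2]; [:: 2; 3; 4]];
      [:: [:: 0; 1; 2]; [:: 0; 1; 3]; [:: 0; 2; 3]; [:: 4]];
      [:: [:: 0; 1; 2]; [:: 0; 1; 3]; [:: 0; 2; 3]; [:: 0; 4]];
      [:: [:: 0; 1; 2]; [:: 0; 1; 3]; [:: 2; 3]; [:: 4]];
      [:: [:: 0; 1; 2]; [:: 0; 1; 3]; [:: 2; 3]; [:: 0; 4]];
      [:: [:: 0; 1; 2]; [:: 0; 3]; [:: 2; 3]; [:: 1; 4]];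
      [:: [:: 0; 1]; [:: 0; 2]; [:: 1; 2]; [:: 3; 4]]].

Definition obstruction (T : finType) (e : rel T) : Prop :=
  isomorphic e (@complete 6) \/
  exists2 N, N \in J_nbhds & isomorphic e (@split5 N).

(* Algorithms are while-programs over a random access machine with finitely   *)
(* many scalar variables and arrays of natural numbers (a program mentions    *)
(* only finitely many names).  Every elementary operation has unit cost.  The *)
(* only arithmetic is successor, predecessor and comparison, so a run of      *)
(* length t raises the largest value by at most t plus a constant: a          *)
(* linear-time run only handles words of O(log (|V| + |E|)) bits, and the     *)
(* unit-cost measure cannot be abused by packing data into huge numbers.      *)

Inductive expr : Type :=
| Num of nat
| Var of nat
| Get of nat & expr
| Succ of expr
| Pred of expr
| Lt of expr & expr
| Eq of expr & expr.

Inductive cmd : Type :=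
| Skip
| Assign of nat & expr
| Store of nat & expr & expr
| Seq of cmd & cmd
| If of expr & cmd & cmd
| While of expr & cmd.

Record state : Type := State { var : nat -> nat; arr : nat -> nat -> nat }.

Definition set_var (s : state) (x v : nat) : state :=
  State (fun y => if y == x then v else var s y) (arr s).

Definition set_arr (s : state) (a i v : nat) : state :=
  State (var s) (fun b j => if (b == a) && (j == i) then v else arr s b j).

Fixpoint eval (s : state) (e : expr) : nat :=
  match e with
  | Num k => k
  | Var x => var s x
  | Get a i => arr s a (eval s i)
  | Succ e1 => (eval s e1).+1
  | Pred e1 => (eval s e1).-1
  | Lt e1 e2 => eval s e1 < eval s e2
  | Eq e1 e2 => eval s e1 == eval s e2
  end.

Fixpoint ecost (e : expr) : nat :=
  match e with
  | Num _ | Var _ => 1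
  | Get _ e1 | Succ e1 | Pred e1 => (ecost e1).+1
  | Lt e1 e2 | Eq e1 e2 => (ecost e1 + ecost e2).+1
  end.

(* exec p s t s' : started in s, the program p halts in s' after t steps.     *)
Inductive exec : cmd -> state -> nat -> state -> Prop :=
| ExecSkip s : exec Skip s 1 s
| ExecAssign s x e : exec (Assign x e) s (ecost e).+1 (set_var s x (eval s e))
| ExecStore s a i e :
    exec (Store a i e) s (ecost i + ecost e).+1
      (set_arr s a (eval s i) (eval s e))
| ExecSeq p q s1 s2 s3 t1 t2 :
    exec p s1 t1 s2 -> exec q s2 t2 s3 -> exec (Seq p q) s1 (t1 + t2) s3
| ExecIfTrue e p q s t s' :
    eval s e != 0 -> exec p s t s' -> exec (If e p q) s (ecost e + t).+1 s'
| ExecIfFalse e p q s t s' :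
    eval s e = 0 -> exec q s t s' -> exec (If e p q) s (ecost e + t).+1 s'
| ExecWhileTrue e p s1 s2 s3 t1 t2 :
    eval s1 e != 0 -> exec p s1 t1 s2 -> exec (While e p) s2 t2 s3 ->
    exec (While e p) s1 (ecost e + t1 + t2).+1 s3
| ExecWhileFalse e p s :
    eval s e = 0 -> exec (While e p) s (ecost e).+1 s.

(* By determinism, "there is a halting run such that ..." describes the       *)
(* unique behavior of the program.                                            *)
Lemma exec_deterministic p s t1 s1 t2 s2 :
  exec p s t1 s1 -> exec p s t2 s2 -> t1 = t2 /\ s1 = s2.
Proof.
move=> E1; elim: E1 t2 s2 => {p s t1 s1} [s|s x e|s a i e
  |p q s1 s2 s3 t1 t2 _ IHp _ IHq|e p q s t s' en0 _ IHp|e p q s t s' e0 _ IHq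
  |e p s1 s2 s3 t1 t2 en0 _ IHp _ IHw|e p s e0] t' r E2;
  inversion E2 as [| | |? ? ? ? ? ? ? Ep Eq|? ? ? ? ? ? en Ep|? ? ? ? ? ? ez Eq
    |? ? ? ? ? ? ? en Ep Ew|? ? ? ez]; subst=> //;
  try by [rewrite ez in en0 | rewrite e0 in en].
- by case: (IHp _ _ Ep) => ? ?; subst; case: (IHq _ _ Eq) => -> ->.
- by case: (IHp _ _ Ep) => -> ->.
- by case: (IHq _ _ Eq) => -> ->.
- by case: (IHp _ _ Ep) => ? ?; subst; case: (IHw _ _ Ew) => -> ->.
Qed.

Section InputOutput.
Variables (n : nat) (e : rel 'I_n).

Definition edge_count : nat :=
  #|[set p : 'I_n * 'I_n | (p.1 < p.2) && e p.1 p.2]|.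

Definition adjacency_lists (nb : 'I_n -> seq 'I_n) : Prop :=
  forall v, perm_eq (nb v) (enum (e v)).

(* Variable 0 holds n.  Array 1 holds the concatenated adjacency lists of the *)
(* vertices 0, ..., n - 1; that of v occupies the indices j such that         *)
(* off v <= j < off v.+1, where off is array 0.  All other cells are 0.       *)
Definition input (nb : 'I_n -> seq 'I_n) : state :=
  let lists := [seq map val (nb v) | v <- enum 'I_n] in
  {| var := fun x => if x == 0 then n else 0;
     arr := fun a i =>
       if a == 0 then sumn (take i (shape lists))
       else if a == 1 then nth 0 (flatten lists) i
       else 0 |}.

Definition answers_yes (s : state) : Prop := var s 1 = 1.
Definition answers_no (s : state) : Prop := var s 1 = 0.

(* The coloring is read off array 2. *)
Definition yes_certificate (s : state) : Prop :=
  exists f : 'I_n -> 'I_5,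
    star_coloring e f /\ forall v : 'I_n, arr s 2 v = f v.

(* The vertices of the induced subgraph are listed, without repetition, in    *)
(* the first (var s 2) cells of array 3.                                      *)
Definition no_certificate (s : state) : Prop :=
  exists W : {set 'I_n},
    perm_eq (mkseq (arr s 3) (var s 2)) (map val (enum W)) /\
    obstruction (@induced _ e W).

End InputOutput.

(* Main.v *)
From mathcomp Require Import all_boot.
From mathcomp Require Import zify.
Require Import Defs.

(** In a split graph with a clique of at most four vertices whose complement is
    independent, giving the clique distinct colors and all other vertices the
    fifth color is a star coloring, because only one class has more than one
    vertex ([star_coloring_one_class]).  A clique of six vertices excludes any
    5-coloring.  The interesting case is a maximum clique of exactly five vertices
    with independent complement.

    In this case the color of a vertex x outside the clique is the color of a
    unique clique vertex, its center, which is not adjacent to x.  A bicolored path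
    on four vertices can only consist of two outside vertices x and y and their
    centers, in the middle, with x adjacent to the center of y and y adjacent to
    the center of x.  So a star 5-coloring amounts to a choice of centers for which
    the arcs from the center of x to the neighbors of x, for all x, contain no
    2-cycle; equivalently, to a tournament on the clique such that the
    neighborhood of each outside vertex lies in some out-neighborhood
    ([star_coloring_of_centers], [split5_centers]).  This depends only on the set of
    neighborhoods, or types, that occur, among 31 proper subsets of the clique.
    A decision tree that queries for the presence of types therefore solves the
    problem in constant time; its leaves are tournaments that fit all types not
    found absent, or copies of some J_i among the types found present.  That such a
    tree exists says that J_1, ..., J_12 are the only obstructions.  The tree is
    computed by a search, and its correctness is checked by evaluation
    ([decision_tree_sound]).  That a no-certificate excludes star 5-colorings is
    again a finite check, over all choices of centers in the J_i
    ([obstruction_not_colorable]).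

    The clique is found in linear time from the degrees.  A set of vertices of
    largest degrees, that is, one with all degrees at least those outside it, is
    a clique if its k members have degree at least k - 1 ([top_clique]), and has
    an independent complement if the other vertices have degree less than k
    ([top_independent]): up to an exchange of twins, it is comparable with a
    maximum clique.  So it is enough to scan the vertices six times for one of
    largest degree, and to look at the fourth, fifth and sixth degrees.  The types
    are then read off the adjacency lists of the five clique vertices.

    The program is verified phase by phase with a total correctness logic that
    carries time bounds ([runs], [runs_for]). *)

Set Implicit Arguments.
Unset Strict Implicit.
Unset Printing Implicit Defensive.

(** * Star colorings with few repeated colors *)

Section Coloring.
Variables (T : finType) (e : rel T).

(** Properness makes consecutive colors differ, so with only two colors they
    alternate along the path.  Star colorings are therefore the proper colorings
    without alternating path, which is the form used below. *)
Lemma bicolored_path k (f : T -> 'I_k) a b c d :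
  proper_coloring e f -> e a b -> e b c -> e c d ->
  #|f @: [set a; b; c; d]| <= 2 -> f a = f c /\ f b = f d.
Proof.
move=> fP eab ebc ecd le2.
have fab := fP _ _ eab; have fbc := fP _ _ ebc; have fcd := fP _ _ ecd.
have two x y z : x \in [set a; b; c; d] -> y \in [set a; b; c; d] ->
    z \in [set a; b; c; d] -> f x != f y -> f y != f z -> f x = f z.
  move=> xP yP zP xy yz; apply/eqP; apply: contraTT le2 => xz.
  rewrite -ltnNge; apply: leq_trans (subset_leq_card (_ : [set f x; f y; f z] \subset _)).
    by rewrite setUC cardsU1 cards2 !inE negb_or xy !(eq_sym (f z)) xz yz.
  by apply/subsetP=> u; rewrite !inE => /orP[/orP[]|] /eqP ->; apply: imset_f.
by split; [apply: (two a b c) | apply: (two b c d)]; rewrite ?inE ?eqxx ?orbT.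
Qed.

Lemma star_coloringI k (f : T -> 'I_k) :
  proper_coloring e f ->
  (forall a b c d, a != c -> b != d -> e a b -> e b c -> e c d ->
     f a = f c -> f b = f d -> False) -> star_coloring e f.
Proof.
move=> fP fN; split=> // a b c d; rewrite /= !inE !negb_or.
case/and4P=> /and3P[_ ac _] /andP[_ bd] _ _ eab ebc ecd.
rewrite ltnNge; apply/negP=> le2.
have [fac fbd] := bicolored_path fP eab ebc ecd le2.
exact: (fN a b c d).
Qed.

(** An alternating path repeats both of its colors, so it cannot exist when
    vertices outside a single class all have different colors. *)
Lemma star_coloring_one_class k (f : T -> 'I_k) (i : 'I_k) :
  {in [pred x | f x != i] &, injective f} -> irreflexive e ->
  independent e [set x | f x == i] -> star_coloring e f.
Proof.
move=> inj irr ind.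
have class x y : f x = f y -> x != y -> f x = i.
  move=> fxy; apply: contra_neq_eq => fx; apply: inj; rewrite ?inE //.
  by rewrite -fxy.
have fP : proper_coloring e f.
  move=> x y exy; apply/eqP=> fxy.
  have xy : x != y by apply: contraTneq exy => ->; rewrite irr.
  have fx := class x y fxy xy.
  by have := negP (ind x y _ _) exy; rewrite !inE -fxy fx eqxx => /(_ isT isT).
apply: star_coloringI => // a b c d ac bd eab _ _ fac fbd.
by have /eqP := fP _ _ eab; rewrite (class a c) // (class b d).
Qed.

(** The clique vertex [K (f x)] is the center of [x].  On an alternating path the
    middle edge meets the clique, and following the path from there shows that
    both middle vertices are in the clique and both ends are outside; the middle
    vertices are then the centers of the ends, and each end is adjacent to the
    center of the other.  So it suffices that no two outside vertices are related
    in this way. *)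
Lemma star_coloring_of_centers k (K : 'I_k -> T) (f : T -> 'I_k) :
  symmetric e -> irreflexive e ->
  (forall i, f (K i) = i) ->
  independent e (~: [set K i | i in 'I_k]) ->
  (forall x, x \notin [set K i | i in 'I_k] -> ~~ e (K (f x)) x) ->
  (forall x y, x \notin [set K i | i in 'I_k] ->
     y \notin [set K i | i in 'I_k] -> ~~ (e (K (f x)) y && e (K (f y)) x)) ->
  star_coloring e f.
Proof.
set C := [set K i | i in 'I_k] => sym irr fK ind own cross.
have KP x : x \in C -> x = K (f x) by case/imsetP=> i _ ->; rewrite fK.
have outP x y : f x = f y -> x != y -> x \in C -> y \notin C.
  by move=> fxy xy /KP xK; apply: contra xy => /KP yK; rewrite xK yK fxy.
have edge x y : e x y -> x \in C \/ y \in C.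
  move=> exy; apply/orP; apply: contraLR exy; rewrite negb_or => /andP[xC yC].
  by apply: ind; rewrite inE.
have fP : proper_coloring e f.
  move=> x y exy; apply/eqP=> fxy.
  have xy : x != y by apply: contraTneq exy => ->; rewrite irr.
  case: (edge _ _ exy) => zC.
    have /own := outP _ _ fxy xy zC; rewrite -fxy -(KP x zC) exy //.
  rewrite eq_sym in xy.
  have /own := outP _ _ (esym fxy) xy zC; rewrite fxy -(KP y zC) sym exy //.
(* An alternating path whose second vertex is in the clique: its last vertex,
   of the same color, is not, hence the third is, hence the first is not. *)
have path a b c d : a != c -> b != d -> e a b -> e b c -> e c d ->
     f a = f c -> f b = f d -> b \in C -> False.
  move=> ac bd eab ebc ecd fac fbd bC.
  have dC := outP _ _ fbd bd bC.
  have cC : c \in C by case: (edge _ _ ecd) => // dC'; rewrite dC' in dC.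
  have aC : a \notin C by apply: (outP c a); rewrite // eq_sym.
  have /negP[] := cross a d aC dC.
  by rewrite fac -fbd -(KP b bC) -(KP c cC) ecd sym eab.
apply: star_coloringI => // a b c d ac bd eab ebc ecd fac fbd.
case: (edge _ _ ebc) => [bC|cC]; first exact: (path a b c d).
by apply: (path d c b a); rewrite 1?eq_sym // sym.
Qed.

End Coloring.

Lemma star_colorable_embed (T U : finType) (e : rel T) (d : rel U) k (g : U -> T) :
  injective g -> (forall x y, d x y -> e (g x) (g y)) ->
  star_colorable e k -> star_colorable d k.
Proof.
move=> gI gE [f [fP fS]]; exists (f \o g); split=> [x y /gE/fP //|a b c h].
move=> u /gE eab /gE ebc /gE ech.
have := fS (g a) (g b) (g c) (g h); rewrite imset_comp !imsetU !imset_set1.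
by apply=> //; rewrite -[[:: _; _; _; _]]/(map g [:: a; b; c; h]) map_inj_uniq.
Qed.

(** * The obstructions have no star 5-coloring *)

Fixpoint center_seqs (N : seq (seq nat)) : seq (seq nat) :=
  if N is _ :: N' then [seq c :: cs | c <- iota 0 5, cs <- center_seqs N']
  else [:: [::]].

Lemma mem_center_seqs N cs :
  size cs = size N -> all (fun c => c < 5) cs -> cs \in center_seqs N.
Proof.
elim: N cs => [|A N IH] [|c cs] // [sz] /andP[c5 csP].
by apply: (@allpairs_f _ _ _ cons); rewrite ?mem_iota ?IH.
Qed.

(** [nth 0 cs i] is the clique vertex with the color of the [i]-th independent
    vertex.  The case [j = i] of the inner condition holds by the outer one. *)
Definition compatible (N : seq (seq nat)) (cs : seq nat) : bool :=
  all (fun i => (nth 0 cs i \notin nth [::] N i) &&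
    all (fun j => ~~ ((nth 0 cs j \in nth [::] N i) && (nth 0 cs i \in nth [::] N j)))
      (iota 0 (size N))) (iota 0 (size N)).

Lemma J_incompatible :
  all (fun N => all (fun cs => ~~ compatible N cs) (center_seqs N)) J_nbhds.
Proof. by vm_compute. Qed.

(** The converse of [star_coloring_of_centers]: two outside vertices, each adjacent
    to the center of the other, form with these centers a bicolored path. *)
Lemma split5_centers N :
  star_colorable (@split5 N) 5 ->
  exists2 cs, cs \in center_seqs N & compatible N cs.
Proof.
case=> f fS; have [fP _] := fS.
pose K (i : 'I_5) : 'I_(5 + size N) := lshift _ i.
have KI : injective (f \o K).
  move=> i j /= fij; apply/eqP; apply: contra_eqT fij => ij.
  by apply: fP; rewrite /split5 /= !ltn_ord.
have [h _ hK] := injF_bij KI.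
pose s (i : 'I_(size N)) : 'I_(5 + size N) := rshift _ i.
pose ctr i := h (f (s i)).
have ctrP i : f (K (ctr i)) = f (s i) := hK _.
have Ks (i : 'I_5) j : split5 (K i) (s j) = (val i \in nth [::] N j).
  by rewrite /split5 /= ltn_ord addKn.
have sK (i : 'I_5) j : split5 (s j) (K i) = (val i \in nth [::] N j).
  by rewrite /split5 /= ltn_ord addKn.
have own i : val (ctr i) \notin nth [::] N i.
  by apply/negP; rewrite -Ks => /fP/eqP; apply; apply: ctrP.
pose cs := codom (fun i => val (ctr i)).
have csE (i : 'I_(size N)) : nth 0 cs i = val (ctr i).
  rewrite (nth_map i) ?size_enum_ord // nth_ord_enum //.
exists cs.
  apply: mem_center_seqs; first by rewrite size_codom card_ord.
  by apply/allP=> _ /codomP[i ->]; apply: ltn_ord.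
apply/allP=> i; rewrite mem_iota => /= iN.
rewrite (csE (Ordinal iN)) (own (Ordinal iN)) /=.
apply/allP=> j; rewrite mem_iota => /= jN.
rewrite (csE (Ordinal jN)).
set a := Ordinal iN; set b := Ordinal jN; apply/negP=> /andP[bi aj].
have ab : ctr b != ctr a :> nat.
  by apply: contraTneq bi => /= ->; apply: own a.
have ij : i != j by apply: contraNneq (own a) => /= ->.
have [_ /(_ (s a) (K (ctr b)) (K (ctr a)) (s b))] := fS.
rewrite sK bi Ks aj /= {1}/split5 /= !ltn_ord ab.
rewrite !inE -!val_eqE /= !negb_or eqn_add2l ab ij.
have ne (c : 'I_5) k : (5 + k == c = false) * (c == 5 + k :> nat = false).
  by split; have := ltn_ord c; lia.
rewrite !ne => /(_ isT isT isT isT).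
rewrite ltnNge => /negP; apply.
apply: leq_trans (subset_leq_card (_ : _ \subset [set f (s a); f (s b)])) _.
  apply/subsetP=> _ /imsetP[x + ->]; rewrite !inE => /orP[/orP[/orP[]|]|] /eqP->;
  by rewrite ?ctrP eqxx ?orbT.
by rewrite cards2; case: eqP.
Qed.

Lemma obstruction_not_colorable (T : finType) (e : rel T) (W : {set T}) :
  obstruction (@induced T e W) -> ~ star_colorable e 5.
Proof.
move=> ob col.
have {}col : star_colorable (@induced _ e W) 5.
  by apply: star_colorable_embed col; first exact: val_inj.
case: ob => [[f [[g gK fK] fE]]|[N NJ [f [[g gK fK] fE]]]].
  have [h [hP _]] : star_colorable (@complete 6) 5.
    apply: star_colorable_embed col; first exact: (can_inj fK).
    by move=> x y; rewrite -fE !fK.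
  have: #|'I_6| <= #|'I_5|; last by rewrite !card_ord.
  apply: (leq_card h) => x y hxy; apply/eqP; apply: contra_eqT hxy; exact: hP.
have /split5_centers[cs csN /idPn[]] : star_colorable (@split5 N) 5.
  apply: star_colorable_embed col; first exact: (can_inj fK).
  by move=> x y; rewrite -fE !fK.
by move/allP: J_incompatible => /(_ N NJ)/allP/(_ cs csN).
Qed.

(** * Vertices of largest degree in a split graph *)

Section Split.
Variables (T : finType) (e : rel T).
Hypotheses (sym : symmetric e) (irr : irreflexive e).

Definition top_set (A : {set T}) : Prop :=
  {in A & ~: A, forall x y, #|e y| <= #|e x|}.

(** Moving to the clique an outside vertex that is adjacent to all of it makes
    every remaining outside neighborhood a proper subset of the clique. *)
Lemma split_max_clique :
  split_graph e -> exists K : {set T}, [/\ clique e K, independent e (~: K)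
    & forall s, s \notin K -> #|e s| < #|K|].
Proof.
case=> K [cK iK].
have nb s : s \notin K -> {subset e s <= K}.
  move=> sK x exs; apply/negPn/negP=> xK.
  by have := negP (iK s x _ _) exs; rewrite !inE sK xK => /(_ isT isT).
have [/existsP[s /andP[sK /subsetP adj]]|/existsPn noadj] :=
    boolP [exists s, (s \notin K) && (K \subset e s)].
  exists (s |: K); split.
  - move=> x y; rewrite !inE => /predU1P[->|xK] /predU1P[->|yK].
    + by rewrite eqxx.
    + by move=> _; apply: adj.
    + by move=> _; rewrite sym; apply: adj.
    + exact: cK.
  - move=> x y; rewrite !inE !negb_or => /andP[_ xK] /andP[_ yK].
    by apply: iK; rewrite inE.
  - move=> t; rewrite !inE negb_or => /andP[_ tK].
    by rewrite cardsU1 sK ltnS subset_leq_card //; apply/subsetP/nb.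
exists K; split=> // s sK; apply: proper_card; rewrite properE.
by have := noadj s; rewrite sK /= => ->; rewrite andbT; apply/subsetP/nb.
Qed.

(** If a set of largest degrees takes [s] from outside the clique and leaves out
    the clique vertex [x], then [#|K| - 1 <= #|e x| <= #|e s| <= #|K| - 1]: all are
    equalities, so [x] has no neighbor outside [K] and [s] is its twin.  As [x] is
    then determined by the neighborhood of [s], the set leaves out only [x]. *)
Lemma top_exchange (K A : {set T}) s x :
  clique e K -> independent e (~: K) -> (forall t, t \notin K -> #|e t| < #|K|) ->
  top_set A -> s \in A -> s \notin K -> x \in K -> x \notin A ->
  e x =i K :\ x /\ e s =i K :\ x.
Proof.
move=> cK iK dK topA sA sK xK xA.
have xN : K :\ x \subset e x.
  by apply/subsetP=> y; rewrite !inE => /andP[yx yK]; apply: cK; rewrite // eq_sym.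
have cardK : #|K| = #|K :\ x|.+1 by rewrite (cardsD1 x K) xK.
have ds : #|e s| <= #|K :\ x| by rewrite -ltnS -cardK dK.
have dx : #|e x| <= #|e s| by apply: topA; rewrite ?inE.
have /eqP exE : #|K :\ x| == #|e x|.
  by rewrite eqn_leq subset_leq_card //= (leq_trans dx).
have exK : e x =i K :\ x.
  by move=> y; rewrite (subset_cardP exE xN).
have esK : e s \subset K :\ x.
  apply/subsetP=> y sy; rewrite !inE; apply/andP; split.
    apply: contraTneq sy => ->; rewrite -topredE /= sym.
    by rewrite [e x s]exK !inE (negPf sK) andbF.
  apply/negPn/negP=> yK.
  by have := negP (iK s y _ _) sy; rewrite !inE sK yK => /(_ isT isT).
split=> // y; apply: (subset_cardP _ esK).
by apply/eqP; rewrite eqn_leq ds /= exE.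
Qed.

(** The degrees bound [#|A|] by [#|K|] unless [A] is inside [K]; then [A] is [K],
    up to an exchange of twins. *)
Lemma top_clique (A : {set T}) :
  split_graph e -> top_set A -> {in A, forall x, #|A| <= #|e x|.+1} -> clique e A.
Proof.
case/split_max_clique=> K [cK iK dK] topA dA.
have [AK|/subsetPn[s0 s0A s0K]] := boolP (A \subset K).
  by move=> x y xA yA; apply: cK; apply: (subsetP AK).
have leA : #|A| <= #|K| by apply: leq_trans (dA _ s0A) (dK _ s0K).
have [x xK xA] : exists2 x, x \in K & x \notin A.
  apply/subsetPn; apply: contra s0K => KA.
  by have /eqP-> : K == A; rewrite ?eqEcard ?KA.
have nbs s : s \in A -> s \notin K -> e s =i K :\ x.
  by move=> sA sK; case: (top_exchange cK iK dK topA sA sK xK xA).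
have KA y : y \in K -> y != x -> y \in A.
  move=> yK yx; apply/negPn/negP=> yA.
  have [_ /(_ y)] := top_exchange cK iK dK topA s0A s0K yK yA.
  by rewrite (nbs _ s0A s0K) !inE yK yx eqxx.
have sub : s0 |: K :\ x \subset A.
  rewrite subUset sub1set s0A; apply/subsetP=> y; rewrite !inE => /andP[yx yK].
  exact: KA.
have AE : A = s0 |: K :\ x.
  apply/esym/eqP; rewrite eqEcard sub cardsU1 !inE (negPf s0K) andbF /=.
  by move: leA; rewrite [in X in X -> _](cardsD1 x K) xK.
have adj y : y \in K -> y != x -> e s0 y.
  by move=> yK yx; have := nbs _ s0A s0K y; rewrite !inE yK yx.
rewrite AE => y z; rewrite !inE => /predU1P[->|/andP[yx yK]] /predU1P[->|/andP[zx zK]].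
- by rewrite eqxx.
- by move=> _; apply: adj.
- by move=> _; rewrite sym; apply: adj.
- exact: cK.
Qed.

(** A clique vertex outside [A] bounds [#|K|] by [#|A|], so [A] contains some
    vertex outside [K] and all of [K] but one vertex, a twin of it. *)
Lemma top_independent (A : {set T}) :
  split_graph e -> top_set A -> {in ~: A, forall x, #|e x| < #|A|} ->
  independent e (~: A).
Proof.
case/split_max_clique=> K [cK iK dK] topA dA.
have [KA|/subsetPn[x xK xA]] := boolP (K \subset A).
  move=> y z yA zA; apply: iK; rewrite inE; apply: contraTN isT => yK.
  - by rewrite inE (subsetP KA) in yA.
  - by rewrite inE (subsetP KA) in zA.
have leK : #|K| <= #|A|.
  apply: leq_trans (dA x _); last by rewrite inE.
  rewrite (cardsD1 x K) xK ltnS subset_leq_card //.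
  by apply/subsetP=> y; rewrite !inE => /andP[yx yK]; apply: cK; rewrite // eq_sym.
have [s sA sK] : exists2 s, s \in A & s \notin K.
  apply/subsetPn; apply: contra xA => AK.
  by have /eqP-> : A == K; rewrite ?eqEcard ?AK.
have [ex es] := top_exchange cK iK dK topA sA sK xK xA.
have KA y : y \in K -> y \notin A -> y = x.
  move=> yK yA; apply/eqP/negPn/negP=> yx.
  have [_ /(_ y)] := top_exchange cK iK dK topA sA sK yK yA.
  by rewrite es !inE yK yx eqxx.
have xout y : y \notin A -> ~~ e x y.
  move=> yA; have := ex y; rewrite !inE unfold_in => ->; apply/negP=> /andP[yx yK].
  by rewrite (KA y yK yA) eqxx in yx.
move=> y z; rewrite !inE => yA zA.
have [yK|yK] := boolP (y \in K); first by rewrite (KA y) // xout.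
have [zK|zK] := boolP (z \in K); first by rewrite sym (KA z) // xout.
by apply: iK; rewrite inE.
Qed.

End Split.

(** * Timed runs of while-programs *)

Fixpoint written_vars (p : cmd) : seq nat :=
  match p with
  | Skip | Store _ _ _ => [::]
  | Assign x _ => [:: x]
  | Seq p q | If _ p q => written_vars p ++ written_vars q
  | While _ p => written_vars p
  end.

Fixpoint written_arrs (p : cmd) : seq nat :=
  match p with
  | Skip | Assign _ _ => [::]
  | Store a _ _ => [:: a]
  | Seq p q | If _ p q => written_arrs p ++ written_arrs q
  | While _ p => written_arrs p
  end.

Definition agree (xs ars : seq nat) (s s' : state) : Prop :=
  (forall x, x \notin xs -> var s' x = var s x) /\
  (forall a i, a \notin ars -> arr s' a i = arr s a i).

Lemma agree_trans xs ars s1 s2 s3 :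
  agree xs ars s1 s2 -> agree xs ars s2 s3 -> agree xs ars s1 s3.
Proof.
by case=> v1 a1 [v2 a2]; split=> [x h|a i h]; rewrite ?v2 ?v1 ?a2 ?a1.
Qed.

Lemma agree_sub xs xs' ars ars' s s' :
  {subset xs <= xs'} -> {subset ars <= ars'} ->
  agree xs ars s s' -> agree xs' ars' s s'.
Proof.
move=> sx sa [v a]; split=> [x h|b i h]; first by apply: v; apply: contra h; apply: sx.
by apply: a; apply: contra h; apply: sa.
Qed.

Definition frame (p : cmd) := agree (written_vars p) (written_arrs p).

Lemma exec_frame p s t s' : exec p s t s' -> frame p s s'.
Proof.
have subl (A B : seq nat) : {subset A <= A ++ B} by move=> x; rewrite mem_cat => ->.
have subr (A B : seq nat) : {subset B <= A ++ B} by move=> x; rewrite mem_cat orbC => ->.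
elim=> {p s t s'} //=.
- by move=> s x e; split=> //= y; rewrite inE => /negPf->.
- by move=> s a i e; split=> //= b j; rewrite inE => /negPf->.
- move=> p q s1 s2 s3 _ _ _ f1 _ f2.
  apply: (@agree_trans _ _ _ s2); first exact: (agree_sub (subl _ _) (subl _ _) f1).
  exact: (agree_sub (subr _ _) (subr _ _) f2).
- by move=> e p q s t s' _ _; apply: agree_sub; apply: subl.
- by move=> e p q s t s' _ _; apply: agree_sub; apply: subr.
- by move=> e p s1 s2 s3 t1 t2 _ _ f1 _; apply: agree_trans.
Qed.

(** Total correctness with a time bound.  Since what a program may write is read
    off its text, the rules below hand a [frame] fact to each continuation, and
    specifications need only mention what changes. *)
Definition runs (p : cmd) (s : state) (t : nat) (Q : state -> Prop) : Prop :=
  exists t' s', [/\ exec p s t' s', t' <= t & Q s'].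

Lemma runs_weaken p s t t' (Q Q' : state -> Prop) :
  runs p s t Q -> t <= t' -> (forall s', frame p s s' -> Q s' -> Q' s') ->
  runs p s t' Q'.
Proof.
case=> u [s' [E le q]] le' QQ; exists u, s'; split=> //; first exact: leq_trans le'.
exact: QQ (exec_frame E) q.
Qed.

Lemma runs_skip s t (Q : state -> Prop) : 0 < t -> Q s -> runs Skip s t Q.
Proof. by exists 1, s; split=> //; constructor. Qed.

Lemma runs_assign x e s t (Q : state -> Prop) :
  ecost e < t -> Q (set_var s x (eval s e)) -> runs (Assign x e) s t Q.
Proof. by eexists _, _; split; [constructor| |]. Qed.

Lemma runs_store a i e s t (Q : state -> Prop) :
  ecost i + ecost e < t -> Q (set_arr s a (eval s i) (eval s e)) ->
  runs (Store a i e) s t Q.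
Proof. by eexists _, _; split; [constructor| |]. Qed.

Lemma runs_seq p q s t1 t2 (Q1 Q2 : state -> Prop) :
  runs p s t1 Q1 -> (forall s', frame p s s' -> Q1 s' -> runs q s' t2 Q2) ->
  runs (Seq p q) s (t1 + t2) Q2.
Proof.
case=> u1 [s1 [E1 le1 q1]] /(_ _ (exec_frame E1) q1)[u2 [s2 [E2 le2 q2]]].
by exists (u1 + u2), s2; split=> //; [apply: ExecSeq E2 | apply: leq_add].
Qed.

Lemma runs_assign_seq x e q s t (Q : state -> Prop) :
  runs q (set_var s x (eval s e)) t Q ->
  runs (Seq (Assign x e) q) s ((ecost e).+1 + t) Q.
Proof.
move=> rq; apply: (runs_seq (Q1 := eq (set_var s x (eval s e)))).
  exact: runs_assign.
by move=> _ _ <-.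
Qed.

Lemma runs_store_seq a i e q s t (Q : state -> Prop) :
  runs q (set_arr s a (eval s i) (eval s e)) t Q ->
  runs (Seq (Store a i e) q) s ((ecost i + ecost e).+1 + t) Q.
Proof.
move=> rq; apply: (runs_seq (Q1 := eq (set_arr s a (eval s i) (eval s e)))).
  exact: runs_store.
by move=> _ _ <-.
Qed.

Lemma runs_if e p q s t (Q : state -> Prop) :
  (eval s e != 0 -> runs p s t Q) -> (eval s e = 0 -> runs q s t Q) ->
  runs (If e p q) s (ecost e + t).+1 Q.
Proof.
move=> rp rq; case: (eqVneq (eval s e) 0) => [e0|e0].
  have [u [s' [E le q']]] := rq e0; exists (ecost e + u).+1, s'; split=> //.
    exact: ExecIfFalse.
  by rewrite ltnS leq_add2l.
have [u [s' [E le q']]] := rp e0; exists (ecost e + u).+1, s'; split=> //.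
  exact: ExecIfTrue.
by rewrite ltnS leq_add2l.
Qed.

Definition For x bound body :=
  While (Lt (Var x) bound) (Seq body (Assign x (Succ (Var x)))).

(** The invariant is indexed by the loop counter, and is to be reestablished for
    the state in which the counter has been incremented.  The counter need not
    start at 0: a loop over the adjacency list of a vertex starts at its offset.
    Besides its body, an iteration takes [ecost bound + 3] steps for the test and 3
    for the increment. *)
Lemma runs_for x bound body s N (B : nat -> nat) (I : nat -> state -> Prop) :
  x \notin written_vars body -> var s x <= N ->
  (forall s', frame (For x bound body) s s' -> eval s' bound = N) ->
  I (var s x) s ->
  (forall s', frame (For x bound body) s s' -> var s' x < N ->
     I (var s' x) s' ->
     runs body s' (B (var s' x))
       (fun r => I (var s' x).+1 (set_var r x (var s' x).+1))) ->
  runs (For x bound body) s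
    (\sum_(var s x <= i < N) (B i + (ecost bound + 6)) + (ecost bound + 3)) (I N).
Proof.
move=> xb; move: {2}(N - var s x) (erefl (N - var s x)) => k.
elim: k s => [|k IH] s dk le bN Is step.
  have ss : frame (For x bound body) s s by [].
  have vN : var s x = N by lia.
  exists (ecost (Lt (Var x) bound)).+1, s; split.
  - by apply: ExecWhileFalse; rewrite /= bN // vN ltnn.
  - by rewrite /=; lia.
  - by rewrite -vN.
have ss : frame (For x bound body) s s by [].
have lt : var s x < N by lia.
have [u [s1 [E1 le1 I1]]] := step s ss lt Is.
pose s2 := set_var s1 x (eval s1 (Succ (Var x))).
have E2 : exec (Seq body (Assign x (Succ (Var x)))) s (u + 3) s2.
  by apply: ExecSeq E1 _; apply: ExecAssign.
have f2 : frame (For x bound body) s s2 := exec_frame E2.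
have v1 : var s1 x = var s x by case: (exec_frame E1) => /(_ x xb).
have v2 : var s2 x = (var s x).+1 by rewrite /= eqxx v1.
have I2 : I (var s2 x) s2 by rewrite v2 /s2 /= v1.
have [||s' f'|s' f'|u' [s' [E' le' I']]] := IH s2 _ _ _ I2.
- by rewrite v2; lia.
- by rewrite v2; lia.
- by apply: bN; apply: agree_trans f2 f'.
- by apply: step; apply: agree_trans f2 f'.
exists (ecost (Lt (Var x) bound) + (u + 3) + u').+1, s'; split=> //.
  by apply: ExecWhileTrue E2 E'; rewrite /= bN // lt.
rewrite (big_ltn lt) /=; rewrite v2 in le'; lia.
Qed.

Fixpoint repeat_cmd (p : nat -> cmd) (k : nat) : cmd :=
  if k is k'.+1 then Seq (repeat_cmd p k') (p k') else Skip.

Lemma runs_repeat (p : nat -> cmd) k s B (I : nat -> state -> Prop) :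
  I 0 s ->
  (forall i s', i < k -> frame (repeat_cmd p k) s s' -> I i s' ->
     runs (p i) s' B (I i.+1)) ->
  runs (repeat_cmd p k) s (k * B).+1 (I k).
Proof.
elim: k => [|k IH] Is step; first exact: runs_skip.
have sub s' : frame (repeat_cmd p k) s s' -> frame (repeat_cmd p k.+1) s s'.
  by apply: agree_sub => x; rewrite /= mem_cat => ->.
rewrite mulSn addnC -addSn.
apply: (runs_seq (Q1 := I k)).
  by apply: IH => // i s' ik /sub f; apply: step => //; apply: ltnW.
by move=> s' /sub f; apply: step.
Qed.

(** Successive stores to one array do not disturb the values of expressions that
    do not read this array. *)
Fixpoint avoids (a : nat) (e : expr) : bool :=
  match e with
  | Num _ | Var _ => true
  | Get b e1 => (b != a) && avoids a e1
  | Succ e1 | Pred e1 => avoids a e1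
  | Lt e1 e2 | Eq e1 e2 => avoids a e1 && avoids a e2
  end.

Lemma eval_set_arr a s i v e : avoids a e -> eval (set_arr s a i v) e = eval s e.
Proof.
elim: e => //= [b e1 IH /andP[/negPf-> /IH->]//|e1 IH /IH->//|e1 IH /IH->//
  |e1 IH1 e2 IH2|e1 IH1 e2 IH2] /andP[/IH1-> /IH2->] //.
Qed.

Fixpoint fill (a k : nat) (es : seq expr) : cmd :=
  if es is e :: es' then Seq (Store a (Num k) e) (fill a k.+1 es') else Skip.

Lemma runs_fill a k es s :
  all (avoids a) es ->
  runs (fill a k es) s (sumn [seq (ecost e).+2 | e <- es]).+1
   (fun s' => forall i, i < size es -> arr s' a (k + i) = eval s (nth (Num 0) es i)).
Proof.
move=> av.
suff H : forall s, runs (fill a k es) s (sumn [seq (ecost e).+2 | e <- es]).+1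
   (fun s' => (forall i, i < k -> arr s' a i = arr s a i) /\
   forall i, i < size es -> arr s' a (k + i) = eval s (nth (Num 0) es i)).
  by apply: runs_weaken (H s) _ _ => // s' _ [].
move=> {}s; elim: es k av s => [|e es IH] k /= av s; first exact: runs_skip.
case/andP: av => ae aes.
rewrite -addnS; apply: (runs_seq (Q1 := fun s' => s' = set_arr s a k (eval s e))).
  by eexists _, _; split; [constructor| |].
move=> _ _ ->; apply: runs_weaken (IH k.+1 aes _) _ _ => // s' _ [lo hi]; split.
  by move=> i ik; rewrite lo /= ?(ltn_eqF ik) ?andbF // ltnW.
case=> [_|i] /=; first by rewrite addn0 lo //= !eqxx.
rewrite ltnS => ies; rewrite addnS -addSn hi // eval_set_arr //.
by apply: (all_nthP _ aes).
Qed.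

Lemma written_vars_fill a k es : written_vars (fill a k es) = [::].
Proof. by elim: es k => //= x es IH k. Qed.

Lemma written_arrs_fill a b k es : b != a -> b \notin written_arrs (fill a k es).
Proof. by move=> ba; elim: es k => //= x es IH k; rewrite inE (negPf ba) IH. Qed.

(** * The phases of the program *)

(** Variable [vB] holds the best candidate of a selection, and [vK i] the [i]-th
    selected vertex.  [aDeg] holds one more than the degree of a vertex, and
    0 once the vertex is selected; [aMark] holds [i.+1] for the [i]-th selected
    vertex and 0 for the others; [aType] holds the set of the selected neighbors of
    a vertex, as a number whose [i]-th bit stands for the [i]-th selected vertex;
    [aRep] maps a type to one more than some vertex of this type, or to 0. *)
Notation vN := 0.
Notation vAns := 1.
Notation vCnt := 2.
Notation vI := 3.
Notation vJ := 4.
Notation vB := 5.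
Notation vK i := (10 + i).
Notation aOff := 0.
Notation aAdj := 1.
Notation aCol := 2.
Notation aOut := 3.
Notation aDeg := 4.
Notation aMark := 5.
Notation aType := 6.
Notation aRep := 7.
Notation aTab := 8.

Notation "p ;; q" := (Seq p q) (at level 60, right associativity).

Definition incr (a : nat) (i : expr) : cmd := Store a i (Succ (Get a i)).

Definition degrees : cmd :=
  Assign vI (Num 0) ;; Assign vJ (Num 0) ;;
  For vI (Var vN) (
    Store aDeg (Var vI) (Num 1) ;;
    For vJ (Get aOff (Succ (Var vI))) (incr aDeg (Var vI))).

(** Cell [n] of [aDeg] is 0, so [n] stands for the absence of any vertex left to
    select. *)
Definition select : cmd :=
  Assign vB (Var vN) ;; Assign vI (Num 0) ;;
  For vI (Var vN)
    (If (Lt (Get aDeg (Var vB)) (Get aDeg (Var vI))) (Assign vB (Var vI)) Skip).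

Definition take_selected (i : nat) : cmd :=
  Assign (vK i) (Var vB) ;;
  Store aDeg (Var vB) (Num 0) ;; Store aMark (Var vB) (Num i.+1).

Definition choose (i : nat) : cmd := select ;; take_selected i.

(** A neighbor occurs once in an adjacency list, so adding [2 ^ i] sets the
    [i]-th bit; the addition unfolds to [2 ^ i] successors. *)
Definition add_type (i : nat) : cmd :=
  Assign vJ (Get aOff (Var (vK i))) ;;
  For vJ (Get aOff (Succ (Var (vK i))))
    (Store aType (Get aAdj (Var vJ))
       (iter (2 ^ i) Succ (Get aType (Get aAdj (Var vJ))))).

Definition types : cmd := repeat_cmd add_type 5.

Definition representatives : cmd :=
  Assign vI (Num 0) ;;
  For vI (Var vN)
    (If (Get aMark (Var vI)) Skip (Store aRep (Get aType (Var vI)) (Succ (Var vI)))).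

(** A selected vertex gets its rank as color, any other vertex the color that
    [tab] gives to its type. *)
Definition answer_yes (tab : seq nat) : cmd :=
  fill aTab 0 (map Num tab) ;; Assign vI (Num 0) ;;
  For vI (Var vN)
    (If (Get aMark (Var vI))
      (Store aCol (Var vI) (Pred (Get aMark (Var vI))))
      (Store aCol (Var vI) (Get aTab (Get aType (Var vI))))) ;;
  Assign vAns (Num 1).

Definition answer_no (es : seq expr) : cmd :=
  fill aOut 0 es ;; Assign vCnt (Num (size es)).

Section Phases.
Variables (n : nat) (e : rel 'I_n) (nb : 'I_n -> seq 'I_n).
Hypotheses (sym : symmetric e) (irr : irreflexive e) (adj : adjacency_lists e nb).

(** What the program uses of the input arrays: [aOff] delimits the adjacency
    lists in [aAdj], and the last offset, a sum of degrees, bounds the time of a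
    scan of all lists. *)
Definition graph_in (s : state) : Prop :=
  [/\ var s vN = n, arr s aOff 0 = 0, arr s aOff n <= 2 * edge_count e &
    forall v : 'I_n, arr s aOff v.+1 = arr s aOff v + #|e v| /\
      forall i, i < #|e v| -> arr s aAdj (arr s aOff v + i) = nth 0 (map val (nb v)) i].

Lemma graph_in_frame p s s' :
  vN \notin written_vars p -> aOff \notin written_arrs p -> aAdj \notin written_arrs p ->
  frame p s s' -> graph_in s -> graph_in s'.
Proof.
move=> vp ap bp [fv fa] [h1 h2 h3 h4]; split; rewrite ?fv ?fa //.
by move=> v; rewrite !fa //; have [-> H] := h4 v; split=> // i /H <-; rewrite fa.
Qed.

Lemma degree_lt v : #|e v| < n.
Proof.
rewrite -[X in _ < X]card_ord -cardsT; apply: proper_card; apply/properP; split.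
  by apply/subsetP.
by exists v; rewrite ?inE // unfold_in irr.
Qed.

(** Each edge is counted once from either end. *)
Lemma sum_degrees : \sum_(v < n) #|e v| <= 2 * edge_count e.
Proof.
rewrite /edge_count; set E := [set p | _].
pose swap (p : 'I_n * 'I_n) := (p.2, p.1).
have -> : \sum_(v < n) #|e v| = #|[set p : 'I_n * 'I_n | e p.1 p.2]|.
  rewrite -sum1_card (eq_bigl (fun p => e p.1 p.2)) => [|p]; last by rewrite inE.
  rewrite -(pair_big_dep xpredT e (fun _ _ => 1)) /=.
  by apply: eq_bigr => v _; rewrite sum1_card.
have sub : [set p : 'I_n * 'I_n | e p.1 p.2] \subset E :|: swap @: E.
  apply/subsetP=> -[u v]; rewrite !inE /= => euv; rewrite euv andbT.
  case: (ltngtP u v) => //= [vu|uv].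
    by apply/imsetP; exists (v, u); rewrite ?inE //= vu sym.
  by rewrite (val_inj uv) irr in euv.
apply: leq_trans (subset_leq_card sub) _.
by rewrite mul2n -addnn (leq_trans (leq_card_setU _ _)) // leq_add2l leq_imset_card.
Qed.

Lemma size_nb v : size (nb v) = #|e v|.
Proof. by rewrite cardE; apply: perm_size. Qed.

Lemma graph_in_input : graph_in (input nb).
Proof.
pose lists := [seq map val (nb v) | v <- enum 'I_n].
have szL : size lists = n by rewrite size_map size_enum_ord.
have szS : size (shape lists) = n by rewrite /shape size_map.
have nthL (v : 'I_n) : nth [::] lists v = map val (nb v).
  by rewrite (nth_map v) ?size_enum_ord // nth_ord_enum.
have offS (v : 'I_n) : sumn (take v.+1 (shape lists)) =
    sumn (take v (shape lists)) + #|e v|.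
  rewrite (take_nth 0) ?szS ?ltn_ord // sumn_rcons.
  by rewrite (nth_map [::]) ?szL ?ltn_ord // nthL size_map size_nb.
split=> //=; first by rewrite take0.
  rewrite -/lists take_oversize ?szS //.
  apply: leq_trans sum_degrees.
  rewrite sumnE /shape big_map big_map big_enum; apply: leq_sum => v _.
  by rewrite size_map size_nb.
move=> v; rewrite -/lists; split=> // i iv.
rewrite -{1}(cat_take_drop v lists) flatten_cat nth_cat size_flatten.
rewrite /shape map_take ltnNge leq_addr /= addKn.
rewrite (drop_nth [::]) ?szL ?ltn_ord //= nth_cat nthL.
by rewrite size_map size_nb iv.
Qed.

Lemma off_mono s i : graph_in s -> i < n -> arr s aOff i <= arr s aOff i.+1.
Proof. by case=> _ _ _ Gv lt; have [/= -> _] := Gv (Ordinal lt); apply: leq_addr. Qed.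

(** The inner loop never resets its counter, so its total time telescopes to the
    last offset. *)
Lemma runs_degrees s :
  graph_in s -> (forall v, arr s aDeg v = 0) ->
  runs degrees s (20 * n + 28 * edge_count e + 20)
    (fun s' => (forall v : 'I_n, arr s' aDeg v = #|e v|.+1) /\
       forall v, n <= v -> arr s' aDeg v = 0).
Proof.
move=> G D0; have [Gn G0 Gm Gv] := G.
set T := 20 * n + _ + 20.
pose I i s' := [/\ var s' vJ = arr s aOff i,
  forall v : 'I_n, v < i -> arr s' aDeg v = #|e v|.+1
  & forall v, i <= v -> arr s' aDeg v = 0].
pose B v := 3 + ((arr s aOff v.+1 - arr s aOff v) * 14 + 6).
apply: (runs_weaken (t := 2 + (2 + (\sum_(0 <= v < n) (B v + 7) + 4))) (Q := I n)).
- apply/runs_assign_seq/runs_assign_seq; set s1 := set_var _ vJ _.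
  apply: (runs_for (s := s1) (I := I)) => //.
  + by move=> s' [fv _]; rewrite /= fv.
  + by split=> //= v; rewrite D0.
  move=> s' [fv fa]; set i := var s' vI => lt [IJ Ilt Ige].
  have le := off_mono G lt.
  have fOff k : arr s' aOff k = arr s aOff k by rewrite fa.
  apply: runs_store_seq; set s2 := set_arr _ _ _ _.
  have vJ2 : var s2 vJ = arr s aOff i by [].
  pose I2 j r := [/\ var r vJ = j, arr s aOff i <= j & forall v, arr r aDeg v =
     if v == i then (j - arr s aOff i).+1 else arr s' aDeg v].
  apply: (runs_weaken (t := \sum_(arr s aOff i <= j < arr s aOff i.+1) 14 + 6)
    (Q := I2 (arr s aOff i.+1))).
  - rewrite -vJ2; apply: (runs_for (B := fun _ => 5) (I := I2)); rewrite ?vJ2 //.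
    + by move=> r [fv' fa']; rewrite /= fv' // fa' //= fOff.
    + by split=> // v /=; rewrite subnn.
    move=> r [fv' _]; set j := var r vJ => jlt [_ jge Ir].
    have rI : var r vI = i by rewrite fv'.
    apply: runs_store => //; rewrite /= rI; split=> // [|v] /=; first exact: leqW.
    by rewrite !Ir eqxx; case: (v == i) => //; lia.
  - by rewrite sum_nat_const_nat.
  move=> r [_ fa'] [rJ _ Ir]; split=> //= v.
    rewrite ltnS leq_eqVlt => /predU1P[vi|vi]; rewrite Ir.
      by rewrite vi eqxx -vi; have [-> _] := Gv v; rewrite addKn.
    by rewrite (ltn_eqF vi) Ilt.
  by move=> iv; rewrite Ir (gtn_eqF iv) Ige // ltnW.
- have tel : \sum_(0 <= v < n) (arr s aOff v.+1 - arr s aOff v) = arr s aOff n.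
    rewrite telescope_sumn_in ?G0 ?subn0 // => v /andP[_ vn] ; exact: off_mono.
  rewrite (eq_bigr (fun v => 14 * (arr s aOff v.+1 - arr s aOff v) + 16)) => [|v _].
    rewrite big_split /= sum_nat_const_nat -big_distrr tel /= /T; lia.
  by rewrite /B; lia.
by move=> s' _ [_ H1 H2]; split=> // v; apply: H1.
Qed.

Definition selected (s : state) : Prop :=
  [/\ var s vB = n \/ (var s vB < n /\ 0 < arr s aDeg (var s vB)) &
      forall v : 'I_n, arr s aDeg v <= arr s aDeg (var s vB)].

Lemma runs_select s :
  var s vN = n -> arr s aDeg n = 0 -> runs select s (15 * n + 8) selected.
Proof.
move=> sn Dn.
pose I i s' := (var s' vB = n \/ (var s' vB < n /\ 0 < arr s' aDeg (var s' vB))) /\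
  forall v, v < i -> arr s' aDeg v <= arr s' aDeg (var s' vB).
apply: (runs_weaken (t := 2 + (2 + (\sum_(0 <= v < n) (8 + 7) + 4))) (Q := I n)).
- apply/runs_assign_seq/runs_assign_seq; set s1 := set_var _ vI _.
  apply: (runs_for (s := s1) (B := fun=> 8) (I := I)) => //.
  + by move=> s' [fv _]; rewrite /= fv.
  + by split=> //=; left.
  move=> s' _ lt [Ib Imax].
  apply: (runs_weaken (t := (5 + 2).+1) (Q := fun r => r = if arr s' aDeg (var s' vB) <
     arr s' aDeg (var s' vI) then set_var s' vB (var s' vI) else s')) => //.
    apply: runs_if => /=; case: (_ < _) => // _.
      exact: runs_assign.
    exact: runs_skip.
  move=> _ _ ->; case: ltnP => [db|db]; split=> //=.
  + by right; split=> //; apply: leq_ltn_trans db.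
  + move=> v; rewrite ltnS leq_eqVlt => /predU1P[->//|/Imax h].
    exact: leq_trans h (ltnW db).
  + by move=> v; rewrite ltnS leq_eqVlt => /predU1P[->//|/Imax h].
- by rewrite sum_nat_const_nat; lia.
by move=> s' _ [Ib Imax]; split=> // v; apply: Imax.
Qed.

Lemma eval_iter_Succ s k x : eval s (iter k Succ x) = eval s x + k.
Proof. by elim: k => [|k /= ->]; rewrite ?addn0 ?addnS. Qed.

Lemma ecost_iter_Succ k x : ecost (iter k Succ x) = ecost x + k.
Proof. by elim: k => [|k /= ->]; rewrite ?addn0 ?addnS. Qed.

Lemma count_nb (x u : 'I_n) : count_mem (val u) (map val (nb x)) = e x u.
Proof.
rewrite count_map (eq_count (a2 := pred1 u)) => [|w]; last by rewrite /= val_eqE.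
rewrite count_uniq_mem ?(perm_mem (adj x)) ?mem_enum //.
by rewrite (perm_uniq (adj x)) enum_uniq.
Qed.

Lemma runs_add_type i s (x : 'I_n) :
  graph_in s -> i < 5 -> var s (vK i) = x ->
  runs (add_type i) s (31 * n + 9)
    (fun s' => forall u : 'I_n, arr s' aType u = arr s aType u + 2 ^ i * e x u).
Proof.
move=> G i5 sx; have [Gn _ _ Gv] := G; have [offS adjE] := Gv x.
set L := map val (nb x) in adjE; set o := arr s aOff x in offS adjE.
have i2 : 2 ^ i <= 16 by rewrite (@leq_pexp2l 2 i 4).
pose I j s' := [/\ var s' vJ = j, o <= j & forall u, arr s' aType u =
  arr s aType u + 2 ^ i * count_mem u (take (j - o) L)].
apply: (runs_weaken (t := 3 + (\sum_(o <= j < arr s aOff x.+1) (22 + 9) + 6))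
  (Q := I (arr s aOff x.+1))).
- apply: runs_assign_seq; rewrite [eval _ _]/= [var _ _]sx -/o; set s1 := set_var _ _ _.
  apply: (runs_for (s := s1) (B := fun=> 22) (I := I)) => //.
  + by rewrite offS leq_addr.
  + by move=> s' [fv fa]; rewrite /= fv ?fa //= [var _ _]sx.
  + by split=> // u; rewrite subnn take0 muln0 addn0.
  move=> s' [fv fa]; set j := var s' vJ => jlt [_ jge IT].
  have cst : (ecost (Get aAdj (Var vJ)) +
     ecost (iter (2 ^ i) Succ (Get aType (Get aAdj (Var vJ))))).+1 <= 22.
    by rewrite ecost_iter_Succ /=; lia.
  apply: runs_store => //.
  rewrite eval_iter_Succ /= -/j; split=> // [|u] /=; first exact: leqW.
  have jo : j - o < size L by rewrite size_map size_nb; lia.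
  have -> : arr s' aAdj j = nth 0 L (j - o).
    by rewrite fa // -adjE ?subnKC // -size_nb -(size_map val).
  rewrite subSn // (take_nth 0) // -cats1 count_cat /= addn0 mulnDr addnA -IT eq_sym.
  by case: eqP => [->|_]; rewrite ?muln1 ?muln0 ?addn0.
- rewrite sum_nat_const_nat offS addKn; have := degree_lt x.
  by lia.
move=> s' _ [_ _ IT] u; rewrite IT -count_nb take_oversize //.
by rewrite size_map size_nb offS addKn.
Qed.

Lemma runs_representatives s :
  var s vN = n -> (forall m, arr s aRep m = 0) ->
  runs representatives s (20 * n + 20) (fun s' =>
    (forall m, arr s' aRep m != 0 -> exists v : 'I_n,
      [/\ arr s' aRep m = v.+1, arr s aMark v = 0 & arr s aType v = m]) /\
    (forall v : 'I_n, arr s aMark v = 0 -> arr s' aRep (arr s aType v) != 0)).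
Proof.
move=> sn R0.
pose I i s' := (forall m, arr s' aRep m != 0 -> exists v : 'I_n,
      [/\ arr s' aRep m = v.+1, arr s aMark v = 0 & arr s aType v = m]) /\
    (forall v : 'I_n, v < i -> arr s aMark v = 0 -> arr s' aRep (arr s aType v) != 0).
apply: (runs_weaken (t := 2 + (\sum_(0 <= v < n) (8 + 7) + 4)) (Q := I n)).
- apply: runs_assign_seq; set s1 := set_var _ vI _.
  apply: (runs_for (s := s1) (B := fun=> 8) (I := I)) => //.
  + by move=> s' [fv _]; rewrite /= fv.
  + by split=> // m; rewrite R0.
  move=> s' [_ fa] lt [I1 I2]; set i := var s' vI.
  have fM : arr s' aMark i = arr s aMark i by rewrite fa.
  have fT : arr s' aType i = arr s aType i by rewrite fa.
  apply: (runs_weaken (t := (2 + 5).+1) (Q := fun r => r = if arr s aMark i == 0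
      then set_arr s' aRep (arr s aType i) i.+1 else s')) => //.
    apply: runs_if => /=; rewrite -/i fM; case: eqP => //.
      by move=> *; apply: runs_skip.
    by move=> _ _; rewrite -fT; apply: runs_store.
  move=> _ _ ->; case: eqP => [M0|M1]; split=> //=.
  + move=> m; have [->|_] := eqVneq m (arr s aType i); last exact: I1.
    by exists (Ordinal lt).
  + move=> v vi Mv; have [//|neq] := eqVneq (arr s aType v) (arr s aType i).
    apply: I2 => //.
    by move: vi; rewrite ltnS leq_eqVlt => /predU1P[vi|//]; rewrite vi eqxx in neq.
  + move=> v vi Mv; apply: I2 => //.
    by move: vi; rewrite ltnS leq_eqVlt => /predU1P[vi|//]; rewrite vi in Mv.
- by rewrite sum_nat_const_nat; lia.
by move=> s' _ [I1 I2]; split=> // v; apply: I2.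
Qed.

Lemma runs_answer_yes tab s :
  var s vN = n ->
  (forall v : 'I_n, arr s aMark v = 0 -> arr s aType v < size tab) ->
  runs (answer_yes tab) s (20 * n + 3 * size tab + 20) (fun s' =>
    var s' vAns = 1 /\ forall v : 'I_n, arr s' aCol v =
      if arr s aMark v == 0 then nth 0 tab (arr s aType v) else (arr s aMark v).-1).
Proof.
move=> sn Tlt.
set col := fun v : nat =>
  if arr s aMark v == 0 then nth 0 tab (arr s aType v) else (arr s aMark v).-1.
pose I i s' := forall v : 'I_n, v < i -> arr s' aCol v = col v.
apply: (runs_weaken (t := (3 * size tab).+1 + (2 + (\sum_(0 <= v < n) (9 + 7) + 4 + 2)))
  (Q := fun s' => var s' vAns = 1 /\ I n s')).
- have av : all (avoids aTab) (map Num tab) by rewrite all_map; apply/allP.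
  apply: (runs_seq (Q1 := fun s' =>
    forall m, m < size tab -> arr s' aTab m = nth 0 tab m)).
    apply: runs_weaken (runs_fill 0 s av) _ _; last first.
      move=> s' _ H m mt; rewrite -[m]add0n H ?size_map //.
      by rewrite (nth_map 0).
    rewrite -map_comp ltnS /= -(size_map Num) ; elim: (tab) => //= x l IH.
    by rewrite size_map in IH *; lia.
  move=> s1 [fv fa] tabE;
  have {}fv x : var s1 x = var s x by rewrite fv // written_vars_fill.
  have {}fa b i : b != aTab -> arr s1 b i = arr s b i.
    by move=> bT; rewrite fa // written_arrs_fill.
  apply: runs_assign_seq; set s2 := set_var _ vI _.
  apply: (runs_seq (Q1 := I n)).
    apply: (runs_for (s := s2) (B := fun=> 9) (I := I)) => //.
    + by move=> s' [fv' _]; rewrite /= fv' //= fv.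
    move=> s' [_ fa'] lt I1; set i := var s' vI.
    have fM : arr s' aMark i = arr s aMark i by rewrite fa' //= fa.
    apply: (runs_weaken (t := (2 + 6).+1)
      (Q := fun r => r = set_arr s' aCol i (col i))) => //.
      rewrite /col; apply: runs_if => /=; rewrite -/i fM; case: eqP => // Mi _.
        by apply: runs_store => //; rewrite /= -/i fM.
      apply: runs_store => //=; rewrite -/i.
      rewrite !fa' //= tabE ?fa //.
      exact: (Tlt (Ordinal lt)).
    move=> _ _ -> v; rewrite ltnS leq_eqVlt /= => /predU1P[->|vi]; first by rewrite eqxx.
    by rewrite (ltn_eqF vi) I1.
  by move=> s' _ I1; apply: runs_assign.
- by rewrite sum_nat_const_nat; lia.
by move=> s' _ [-> I1]; split=> // v; apply: I1.
Qed.

End Phases.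

(** * Decision trees on the set of types *)

Definition bit (m i : nat) : bool := odd (iter i half m).

Lemma bit_sum (b : nat -> bool) i :
  i < 5 -> bit (\sum_(j < 5) 2 ^ j * b j) i = b i.
Proof.
rewrite !big_ord_recl big_ord0 /= /bump /= !addn0.
case: i => [|[|[|[|[|//]]]]] _;
  by case: (b 0); case: (b 1); case: (b 2); case: (b 3); case: (b 4).
Qed.

Lemma sum_bits_lt (b : nat -> bool) :
  (exists2 i, i < 5 & ~~ b i) -> \sum_(j < 5) 2 ^ j * b j < 31.
Proof.
rewrite !big_ord_recl big_ord0 /= /bump /= !addn0 => -[i].
case: i => [|[|[|[|[|//]]]]] _ /negPf -> ;
  by repeat match goal with |- context [nat_of_bool (b ?k)] => case: (b k) end.
Qed.

(** An orientation of the complete graph on the five clique vertices is given by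
    the list [o] of the masks of their out-neighborhoods.  A vertex may have any
    center whose out-neighborhood contains its type; the first one is taken, with
    value 5 if there is none. *)
Definition submask (m o : nat) : bool :=
  all (fun i => bit m i ==> bit o i) (iota 0 5).

Definition center (o : seq nat) (m : nat) : nat := find (submask m) o.

Definition antisym (o : seq nat) : bool :=
  all (fun c => all (fun d => ~~ (bit (nth 0 o c) d && bit (nth 0 o d) c))
     (iota 0 5)) (iota 0 5).

(** A tree that queries which types occur.  A leaf is either an orientation, or an
    obstruction [N] together with the labels [pi] of its clique and the types
    [ms] of its independent vertices under this labeling. *)
Inductive dtree : Type :=
| Orient of seq nat
| Obstruct of seq (seq nat) & seq nat & seq nat
| Ask of nat & dtree & dtree.

(** [pres] and [abs] are the types known to occur and known not to occur.  Type 31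
    is excluded: a vertex of this type would extend the clique. *)
Fixpoint sound (pres abs : seq nat) (t : dtree) : bool :=
  match t with
  | Orient o =>
      [&& size o == 5, antisym o &
        all (fun m => (m \in abs) || (center o m < 5)) (iota 0 31)]
  | Obstruct N pi ms =>
      [&& N \in J_nbhds, perm_eq pi (iota 0 5), uniq ms,
        all (mem pres) ms, size ms == size N &
        all (fun i => all (fun j => bit (nth 0 ms j) (nth 0 pi i) == (i \in nth [::] N j))
          (iota 0 (size N))) (iota 0 5)]
  | Ask m t1 t2 => sound (m :: pres) abs t1 && sound pres (m :: abs) t2
  end.

Fixpoint compile (t : dtree) : cmd :=
  match t with
  | Orient o => answer_yes [seq center o m | m <- iota 0 31]
  | Obstruct N pi ms =>
      answer_no ([seq Var (vK i) | i <- pi] ++ [seq Pred (Get aRep (Num m)) | m <- ms])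
  | Ask m t1 t2 => If (Get aRep (Num m)) (compile t1) (compile t2)
  end.

Fixpoint dtree_cost (t : dtree) : nat :=
  match t with
  | Orient _ => 116
  | Obstruct _ pi ms => 3 * size pi + 5 * size ms + 3
  | Ask _ t1 t2 => 3 + (dtree_cost t1 + dtree_cost t2)
  end.

(** A list of distinct vertices with the adjacencies of [d] is both the output of
    the program and the isomorphism that makes this output a certificate. *)
Lemma induced_seq n (e : rel 'I_n) m (d : rel 'I_m) (ws : seq 'I_n) x0 :
  uniq ws -> size ws = m ->
  (forall i j : 'I_m, e (nth x0 ws i) (nth x0 ws j) = d i j) ->
  perm_eq (map val ws) (map val (enum [set x in ws])) /\
  isomorphic (@induced _ e [set x in ws]) d.
Proof.
move=> uws sz eE; split.
  apply/perm_map/uniq_perm => //; first exact: enum_uniq.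
  by move=> x; rewrite mem_enum inE.
have gP (i : 'I_m) : nth x0 ws i \in [set x in ws] by rewrite inE mem_nth // sz.
have wsP (x : {x | x \in [set x in ws]}) : val x \in ws.
  by rewrite -[_ \in ws](in_set (mem ws)); apply: valP.
have fP (x : {x | x \in [set x in ws]}) : index (val x) ws < m.
  by rewrite -sz index_mem wsP.
exists (fun x => Ordinal (fP x)); split.
  exists (fun i : 'I_m => Sub (nth x0 ws i) (gP i)) => [x|i]; apply: val_inj => /=.
    exact/nth_index/wsP.
  by rewrite index_uniq // sz.
by move=> x y; rewrite -eE /= !nth_index ?wsP.
Qed.

Definition certified n (e : rel 'I_n) (s : state) : Prop :=
  (answers_yes s /\ yes_certificate e s) \/ (answers_no s /\ no_certificate e s).

Lemma runs_answer_no n (e : rel 'I_n) s es m (d : rel 'I_m) (ws : seq 'I_n) x0 :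
  var s vAns = 0 -> all (avoids aOut) es -> map (eval s) es = map val ws ->
  uniq ws -> size ws = m ->
  (forall i j : 'I_m, e (nth x0 ws i) (nth x0 ws j) = d i j) ->
  (forall W, isomorphic (@induced _ e W) d -> obstruction (@induced _ e W)) ->
  runs (answer_no es) s ((sumn [seq (ecost x).+2 | x <- es]).+1 + 2) (certified e).
Proof.
move=> s1 av esE uws sz eE ob.
apply: runs_seq (runs_fill 0 s av) _ => s' [fv _] E; apply: runs_assign => //.
have [pW iW] := induced_seq uws sz eE; right; split.
  by rewrite /answers_no /= fv // written_vars_fill.
exists [set x in ws]; split; last exact: ob.
suff -> : mkseq (arr s' aOut) (size es) = map val ws by [].
rewrite -esE -[in RHS](mkseq_nth (Num 0) es) /mkseq -map_comp.
by apply/eq_in_map => i; rewrite mem_iota => /E.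
Qed.

Section Tree.
Variables (n : nat) (e : rel 'I_n) (X : nat -> 'I_n) (s : state).
Hypotheses (sym : symmetric e) (irr : irreflexive e).
Let type (v : 'I_n) := \sum_(i < 5) 2 ^ i * e (X i) v.
Hypotheses (sN : var s vN = n) (sAns : var s vAns = 0)
  (sK : forall i, i < 5 -> var s (vK i) = X i)
  (markX : forall i, i < 5 -> arr s aMark (X i) = i.+1)
  (Xmark : forall v : 'I_n, arr s aMark v != 0 ->
     arr s aMark v <= 5 /\ v = X (arr s aMark v).-1)
  (clX : forall i j, i < 5 -> j < 5 -> i != j -> e (X i) (X j))
  (ind : forall u v : 'I_n, arr s aMark u = 0 -> arr s aMark v = 0 -> ~~ e u v)
  (notfull : forall v : 'I_n, arr s aMark v = 0 -> exists2 i, i < 5 & ~~ e (X i) v)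
  (typeE : forall v : 'I_n, arr s aMark v = 0 -> arr s aType v = type v)
  (rep_sound : forall m, arr s aRep m != 0 -> exists v : 'I_n,
      [/\ arr s aRep m = v.+1, arr s aMark v = 0 & arr s aType v = m])
  (rep_full : forall v : 'I_n, arr s aMark v = 0 -> arr s aRep (arr s aType v) != 0).

Lemma bit_type i (v : 'I_n) :
  i < 5 -> arr s aMark v = 0 -> bit (arr s aType v) i = e (X i) v.
Proof. by move=> i5 mv; rewrite typeE // (bit_sum (fun i => e (X i) v)). Qed.

Lemma type_lt (v : 'I_n) : arr s aMark v = 0 -> arr s aType v < 31.
Proof. by move=> mv; rewrite typeE //; apply: sum_bits_lt (notfull mv). Qed.

(** Out-neighborhoods of an orientation have no 2-cycle and no loop, which is
    what [star_coloring_of_centers] asks of the arcs from the center of a vertex to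
    its clique neighbors. *)
Lemma runs_orient abs o :
  {in abs, forall m, arr s aRep m = 0} ->
  sound [::] abs (Orient o) ->
  runs (compile (Orient o)) s (20 * n + 116) (certified e).
Proof.
move=> absE /and3P[/eqP so anti /allP covered].
have ctr (v : 'I_n) : arr s aMark v = 0 -> center o (arr s aType v) < 5.
  move=> mv; have := covered (arr s aType v).
  rewrite mem_iota add0n leq0n => /(_ (type_lt mv))/orP[/absE r0|//].
  by have := rep_full mv; rewrite r0.
apply: runs_weaken (runs_answer_yes sN _) _ _.
- by move=> v mv; rewrite size_map size_iota type_lt.
- by rewrite size_map size_iota; lia.
move=> s' _ [yes colE]; left; split=> //.
have colP (v : 'I_n) : arr s' aCol v = if arr s aMark v == 0 then
     center o (arr s aType v) else (arr s aMark v).-1.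
  rewrite colE; case: eqP => // mv.
  have lt := type_lt mv.
  by rewrite (nth_map 0) ?size_iota ?nth_iota.
have col5 (v : 'I_n) : arr s' aCol v < 5.
  rewrite colP; case: eqP => [/ctr//|/eqP /[dup] + /Xmark[+ _]].
  by case: (arr s aMark v).
have own (v : 'I_n) : arr s aMark v = 0 ->
    submask (arr s aType v) (nth 0 o (arr s' aCol v)).
  move=> mv; rewrite colP mv /=; apply: nth_find.
  by rewrite has_find so ctr.
have arc c (v : 'I_n) : c < 5 -> arr s aMark v = 0 -> e (X c) v ->
    bit (nth 0 o (arr s' aCol v)) c.
  move=> c5 mv; rewrite -bit_type //.
  by have /allP/(_ c) := own v mv; rewrite mem_iota add0n c5 => /(_ isT)/implyP.
have noarc c d : c < 5 -> d < 5 -> ~~ (bit (nth 0 o c) d && bit (nth 0 o d) c).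
  move=> c5 d5; have /allP/(_ c) := anti.
  rewrite mem_iota add0n c5 => /(_ isT)/allP/(_ d).
  by rewrite mem_iota add0n d5; apply.
have mark0 (v : 'I_n) : v \notin [set X (val i) | i in 'I_5] -> arr s aMark v = 0.
  move=> vX; apply/eqP; apply: contraNT vX => /[dup] mv /Xmark[m5 vE].
  have lt : (arr s aMark v).-1 < 5 by move: mv m5; case: (arr s aMark v).
  by apply/imsetP; exists (Ordinal lt).
exists (fun v => Ordinal (col5 v)); split=> //.
apply: (star_coloring_of_centers (K := fun i : 'I_5 => X i)) => //=.
- by move=> i; apply: val_inj; rewrite /= colP markX.
- move=> u v; rewrite !inE => /mark0 mu /mark0 mv; exact: ind.
- move=> v /mark0 mv; apply/negP=> /(arc _ _ (col5 v) mv) b.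
  by have /negP[] := noarc _ _ (col5 v) (col5 v); rewrite b.
move=> u v /mark0 mu /mark0 mv; apply/negP=> /andP[ev eu].
have /negP[] := noarc _ _ (col5 u) (col5 v).
by rewrite (arc _ _ (col5 u) mv ev) (arc _ _ (col5 v) mu eu).
Qed.

Lemma runs_obstruct pres N pi ms :
  {in pres, forall m, arr s aRep m != 0} ->
  sound pres [::] (Obstruct N pi ms) ->
  runs (compile (Obstruct N pi ms)) s (dtree_cost (Obstruct N pi ms)) (certified e).
Proof.
move=> presE /and5P[NJ piP ums /allP mspres /andP[/eqP sms /allP adjE]].
pose rep m := insubd (X 0) (arr s aRep m).-1.
have repP m : m \in ms -> [/\ arr s aRep m = (rep m).+1, arr s aMark (rep m) = 0
    & arr s aType (rep m) = m].
  move=> /mspres/presE/rep_sound[v [rE mv tv]].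
  by have -> : rep m = v by apply: val_inj; rewrite /rep rE val_insubd ltn_ord.
have pi5 i : i \in pi -> i < 5 by rewrite (perm_mem piP) mem_iota.
have spi : size pi = 5 by rewrite (perm_size piP) size_iota.
have upi : uniq pi by rewrite (perm_uniq piP) iota_uniq.
pose ws := map X pi ++ map rep ms.
have uws : uniq ws.
  rewrite cat_uniq !map_inj_in_uniq ?upi ?ums ?andbT /=.
  - apply/hasPn=> _ /mapP[m /repP[_ m0 _] ->]; apply/negP=> /mapP[i /pi5 i5 rE].
    by have := markX i5; rewrite -rE m0.
  - by move=> m1 m2 /repP[_ _ t1] /repP[_ _ t2] E; rewrite -t1 -t2 E.
  - by move=> i j /pi5/markX mi /pi5/markX mj E; move: mi; rewrite E mj => -[].
have sz : size ws = 5 + size N by rewrite size_cat !size_map spi sms.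
apply: runs_weaken
  (@runs_answer_no n e s _ _ (@split5 N) ws (X 0) sAns _ _ uws sz _ _) _ _ => //.
- by rewrite all_cat !all_map; apply/andP; split; apply/allP.
- rewrite /ws !map_cat -!map_comp; congr (_ ++ _); apply/eq_in_map.
    by move=> i /pi5 /sK.
  by move=> m /repP[/= -> _ _].
- have lo (i : 'I_(5 + size N)) : i < 5 ->
      nth (X 0) ws i = X (nth 0 pi i) /\ nth 0 pi i < 5.
    move=> i5; rewrite nth_cat size_map spi i5 (nth_map 0) ?spi //; split=> //.
    by apply: pi5; rewrite mem_nth ?spi.
  have hi (i : 'I_(5 + size N)) : 5 <= i ->
      nth (X 0) ws i = rep (nth 0 ms (i - 5)) /\ i - 5 < size ms.
    move=> i5; have lt : i - 5 < size ms by rewrite sms; have := ltn_ord i; lia.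
    by split=> //; rewrite nth_cat size_map spi ltnNge i5 /= (nth_map 0).
  have mixed (i j : 'I_(5 + size N)) : i < 5 -> 5 <= j ->
      e (nth (X 0) ws i) (nth (X 0) ws j) = (val i \in nth [::] N (j - 5)).
    move=> i5 j5; have [-> pii] := lo i i5; have [-> jlt] := hi j j5.
    have [_ m0 tE] := repP _ (mem_nth 0 jlt).
    rewrite -bit_type // tE; apply/eqP/(allP (adjE i _)); rewrite mem_iota //.
    by move: jlt; rewrite sms.
  move=> i j; rewrite /split5; case: ltnP => i5; case: ltnP => j5 /=.
  + have [-> pii] := lo i i5; have [-> pij] := lo j j5.
    have [ij|ij] := eqVneq i j; first by rewrite ij irr.
    by rewrite clX // nth_uniq ?spi.
  + exact: mixed.
  + by rewrite sym mixed.
  have [-> jlt] := hi j j5; have [-> ilt] := hi i i5.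
  have [_ mi _] := repP _ (mem_nth 0 ilt); have [_ mj _] := repP _ (mem_nth 0 jlt).
  by apply/negbTE/ind.
- by move=> W iso; right; exists N.
have sumc c (l : seq nat) : sumn [seq c | _ <- l] = c * size l.
  by elim: l => [|x l /= ->]; rewrite ?muln0 ?mulnS.
by rewrite map_cat sumn_cat -!map_comp (sumc 3) (sumc 5) /=; lia.
Qed.

Lemma runs_compile t pres abs :
  {in pres, forall m, arr s aRep m != 0} -> {in abs, forall m, arr s aRep m = 0} ->
  sound pres abs t -> runs (compile t) s (20 * n + dtree_cost t) (certified e).
Proof.
elim: t pres abs => [o|N pi ms|m t1 IH1 t2 IH2] pres abs presE absE.
- by move=> so; apply: (runs_orient absE so).
- move=> so; apply: runs_weaken (runs_obstruct presE so) _ _ => //.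
  exact: leq_addl.
case/andP=> so1 so2; rewrite /= addnCA !add3n.
apply: runs_if => /= r.
  apply: runs_weaken (IH1 _ _ _ absE so1) _ _ => //; last by lia.
  by move=> k; rewrite inE => /predU1P[->//|/presE].
apply: runs_weaken (IH2 _ _ presE _ so2) _ _ => //; last by lia.
by move=> k; rewrite inE => /predU1P[->//|/absE].
Qed.

End Tree.

(** * The decision procedure *)

(** The fifth selection is tested before it is marked: when its degree is below 4,
    all unmarked vertices form one independent color class.  The sixth is never
    marked; its degree separates cliques of size 5 from larger ones. *)
Definition decide (t : dtree) : cmd :=
  degrees ;; repeat_cmd choose 4 ;; select ;;
  If (Lt (Get aDeg (Var vB)) (Num 5)) (answer_yes [:: 4])
    (take_selected 4 ;; select ;;
     If (Lt (Num 5) (Get aDeg (Var vB)))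
       (answer_no (rcons [seq Var (vK i) | i <- iota 0 5] (Var vB)))
       (types ;; representatives ;; compile t)).

Section Decide.
Variables (n : nat) (e : rel 'I_n) (nb : 'I_n -> seq 'I_n).
Hypotheses (sym : symmetric e) (irr : irreflexive e) (adj : adjacency_lists e nb).
Hypothesis splitG : split_graph e.

(** Whether [vK] holds genuine vertices: a selection from no remaining vertex
    stores [n]. *)
Definition full (i : nat) (s : state) : Prop :=
  forall k, k < i -> exists2 v : 'I_n, var s (vK k) = v & arr s aMark v = k.+1.

(** The state after [i] selections.  The marked vertices have the largest degrees;
    there may be fewer than [i] of them, but only if all vertices are marked. *)
Record chosen (i : nat) (s : state) : Prop := Chosen {
  unmarked_deg : forall v : 'I_n, arr s aMark v = 0 -> arr s aDeg v = #|e v|.+1;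
  marked : forall v : 'I_n, arr s aMark v != 0 ->
    [/\ arr s aMark v <= i, arr s aDeg v = 0 & var s (vK (arr s aMark v).-1) = v];
  marked_top : forall u v : 'I_n,
    arr s aMark u = 0 -> arr s aMark v != 0 -> #|e u| <= #|e v|;
  unmarked_full : forall u : 'I_n, arr s aMark u = 0 -> full i s;
  deg_out : arr s aDeg n = 0 }.

Lemma chosen_agree i s s' :
  (forall k, var s' (vK k) = var s (vK k)) ->
  (forall v, arr s' aMark v = arr s aMark v) ->
  (forall v, arr s' aDeg v = arr s aDeg v) -> chosen i s -> chosen i s'.
Proof.
move=> fK fM fD [h1 h2 h3 h4 h5]; split.
- by move=> v; rewrite fM fD; apply: h1.
- by move=> v; rewrite !fM fD fK; apply: h2.
- by move=> u v; rewrite !fM; apply: h3.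
- move=> u; rewrite fM => /h4 H k ki; have [v vE mE] := H k ki.
  by exists v; rewrite ?fK ?fM.
- by rewrite fD.
Qed.

Lemma selected_unmarked i s :
  chosen i s -> selected n s -> 0 < arr s aDeg (var s vB) ->
  exists2 b : 'I_n, var s vB = b & arr s aMark b = 0.
Proof.
move=> C [[->|[lt _]] _]; first by rewrite (deg_out C).
move=> pos; exists (Ordinal lt) => //; apply/eqP/negPn/negP=> /(marked C)[_ D0 _].
by rewrite /= D0 in pos.
Qed.

Lemma runs_take i s :
  chosen i s -> selected n s ->
  runs (take_selected i) s 8 (fun s' => chosen i.+1 s' /\
    (0 < arr s aDeg (var s vB) -> full i.+1 s' /\
      forall v : 'I_n, arr s' aMark v != 0 -> arr s aDeg (var s vB) <= #|e v|.+1)).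
Proof.
move=> C S; apply: runs_assign_seq; apply: runs_store_seq; apply: runs_store => //=.
have KK k : (vK k == vK i) = (k == i) by rewrite eqn_add2l.
have [pos|] := ltnP 0 (arr s aDeg (var s vB)).
  have [b bE mb] := selected_unmarked C S pos; rewrite bE.
  set s' := set_arr _ _ _ _.
  have sM (v : 'I_n) : arr s' aMark v = if v == b then i.+1 else arr s aMark v by [].
  have sD (v : 'I_n) : arr s' aDeg v = if v == b then 0 else arr s aDeg v by [].
  have sK k : var s' (vK k) = if k == i then val b else var s (vK k).
    by rewrite /= KK.
  have sKlt k : k < i -> var s' (vK k) = var s (vK k).
    by move=> ki; rewrite sK (ltn_eqF ki).
  have Dmax (u : 'I_n) : arr s aMark u = 0 -> #|e u| <= #|e b|.
    move=> mu; rewrite -ltnS -(unmarked_deg C mu) -(unmarked_deg C mb) -bE.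
    by case: S.
  have full' : full i.+1 s'.
    move=> k; rewrite ltnS leq_eqVlt => /predU1P[->|ki].
      by exists b; rewrite ?sK ?sM eqxx.
    have [v vE mE] := unmarked_full C mb ki; exists v; rewrite ?sKlt // sM.
    by have [vb|//] := eqVneq v b; rewrite vb mb in mE.
  split; last first.
    move=> _; split=> // v; rewrite -/(_ != _) -[if _ then _ else _]sM sM.
    rewrite (unmarked_deg C mb) ltnS; have [-> //|_ mv] := eqVneq v b.
    exact: (marked_top C mb mv).
  split=> //.
  - by move=> v; rewrite sM sD; case: eqVneq => // _; apply: (unmarked_deg C).
  - move=> v; rewrite sM sD; have [-> _|_ mv] := eqVneq v b; first by rewrite sK eqxx.
    have [mi D0 vE] := marked C mv; split=> //; first exact: leqW.
    by rewrite sKlt // -ltnS prednK ?lt0n.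
  - move=> u v; rewrite !sM; case: eqVneq => // _ mu.
    have [-> _|_ mv] := eqVneq v b; first exact: Dmax.
    exact: (marked_top C mu mv).
  - by rewrite /= (gtn_eqF (ltn_ord b)) (deg_out C).
rewrite leqn0 => /eqP Db; rewrite Db; split=> //.
have bn : var s vB = n by case: S => -[//|[]]; rewrite Db.
rewrite bn; set s' := set_arr _ _ _ _.
have sM (v : 'I_n) : arr s' aMark v = arr s aMark v.
  by rewrite /= (ltn_eqF (ltn_ord v)).
have sD (v : 'I_n) : arr s' aDeg v = arr s aDeg v.
  by rewrite /= (ltn_eqF (ltn_ord v)).
have allm (u : 'I_n) : arr s aMark u = 0 -> False.
  by case: S => _ /(_ u); rewrite Db => Du /(unmarked_deg C) DE; rewrite DE in Du.
split; try by move=> u; rewrite sM => /allm.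
- move=> v; rewrite !sM sD => mv; have [mi D0 vE] := marked C mv.
  split=> //; first exact: leqW.
  have lt : (arr s aMark v).-1 < i by rewrite prednK ?lt0n.
  by rewrite /= KK (ltn_eqF lt).
- by move=> u v; rewrite sM => /allm.
- by rewrite /= eqxx.
Qed.

Lemma chosen_frame p i s s' :
  (forall k, vK k \notin written_vars p) -> aMark \notin written_arrs p ->
  aDeg \notin written_arrs p -> frame p s s' -> chosen i s -> chosen i s'.
Proof.
move=> pK pM pD [fv fa]; apply: chosen_agree => k; [exact: fv|exact: fa|exact: fa].
Qed.

Lemma runs_select_chosen i s :
  var s vN = n -> chosen i s ->
  runs select s (15 * n + 8) (fun s' => chosen i s' /\ selected n s').
Proof.
move=> sn C; apply: runs_weaken (runs_select sn (deg_out C)) _ _ => // s' f S.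
by split=> //; apply: chosen_frame f C.
Qed.

Lemma runs_choose4 s :
  var s vN = n -> chosen 0 s -> runs (repeat_cmd choose 4) s (60 * n + 65) (chosen 4).
Proof.
move=> sn C.
apply: (runs_weaken (t := (4 * (15 * n + 8 + 8)).+1) (Q := chosen 4)) => //; last by lia.
apply: runs_repeat => // i s' _ [fv _] C'.
have sn' : var s' vN = n by rewrite fv.
apply: runs_seq (runs_select_chosen sn' C') _ => s1 _ [C1 S1].
by apply: runs_weaken (runs_take C1 S1) _ _ => // s2 _ [].
Qed.

(** Here the unmarked vertices have degree less than 4; if there is one, then
    four vertices are marked, and [top_independent] applies. *)
Lemma runs_few s :
  var s vN = n -> chosen 4 s -> selected n s -> arr s aDeg (var s vB) < 5 ->
  (forall v, arr s aType v = 0) ->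
  runs (answer_yes [:: 4]) s (20 * n + 116) (certified e).
Proof.
move=> sn C [_ Dmax] Db T0.
apply: runs_weaken (runs_answer_yes sn _) _ _; first by move=> v _; rewrite T0.
  by rewrite /=; lia.
move=> s' _ [yes colE]; left; split=> //.
have {}colE (v : 'I_n) :
    arr s' aCol v = if arr s aMark v == 0 then 4 else (arr s aMark v).-1.
  by rewrite colE T0.
have mark_lt (v : 'I_n) : arr s aMark v != 0 -> (arr s aMark v).-1 < 4.
  by move=> mv; have [m4 _ _] := marked C mv; rewrite -ltnS prednK ?lt0n.
have col5 (v : 'I_n) : arr s' aCol v < 5.
  by rewrite colE; case: eqP => // /eqP /mark_lt /ltnW.
have col4 (v : 'I_n) : (arr s' aCol v == 4) = (arr s aMark v == 0).
  by rewrite colE; case: (eqVneq (arr s aMark v)) => // /mark_lt; case: ltngtP.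
exists (fun v => Ordinal (col5 v)); split=> //.
apply: (star_coloring_one_class (i := Ordinal (isT : 4 < 5))) => //.
  move=> u v; rewrite !inE -!val_eqE /= !col4 => mu mv [].
  rewrite !colE (negPf mu) (negPf mv) => muv; apply: val_inj => /=.
  have [_ _ <-] := marked C mu; have [_ _ <-] := marked C mv.
  by rewrite muv.
move=> u v; rewrite !inE -!val_eqE /= !col4 => /eqP mu /eqP mv.
pose A := [set w : 'I_n | arr s aMark w != 0].
have /(_ u v) : independent e (~: A).
  apply: top_independent => //.
    by move=> x y; rewrite !inE negbK => mx /eqP my; apply: (marked_top C my mx).
  move=> x; rewrite !inE negbK => /eqP mx.
  have dx : #|e x| < 4 by rewrite -ltnS -(unmarked_deg C mx) (leq_ltn_trans (Dmax x)).
  apply: leq_trans dx _.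
  have F (k : 'I_4) : exists w : 'I_n, (arr s aMark w == k.+1).
    by have [w _ mw] := unmarked_full C mu (ltn_ord k); exists w; rewrite mw.
  pose W k := xchoose (F k); have WE k : arr s aMark (W k) = k.+1 := eqP (xchooseP (F k)).
  rewrite -[4]card_ord -(card_codom (f := W)) => [|j k jk]; last first.
    by apply/val_inj/succn_inj; rewrite -!WE jk.
  by apply/subset_leq_card/subsetP=> _ /codomP[k ->]; rewrite inE WE.
by apply; rewrite !inE negbK ?mu ?mv.
Qed.

Lemma runs_types s (X : nat -> 'I_n) :
  graph_in e nb s -> (forall i, i < 5 -> var s (vK i) = X i) ->
  (forall u, arr s aType u = 0) ->
  runs types s (155 * n + 46)
   (fun s' => forall u : 'I_n, arr s' aType u = \sum_(j < 5) 2 ^ j * e (X j) u).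
Proof.
move=> G sX T0.
pose I i s' := forall u : 'I_n, arr s' aType u = \sum_(j < i) 2 ^ j * e (X j) u.
apply: (runs_weaken (t := (5 * (31 * n + 9)).+1) (Q := I 5)) => //; last by lia.
apply: runs_repeat => [u|i s' i5 f IT]; first by rewrite big_ord0.
have sX' : var s' (vK i) = X i by case: f => fv _; rewrite fv ?sX.
have G' : graph_in e nb s' by apply: graph_in_frame f G.
apply: runs_weaken (runs_add_type irr adj G' i5 sX') _ _ => // r _ E u.
by rewrite E IT big_ord_recr.
Qed.

Section Five.
Variable s : state.
Hypotheses (Gs : graph_in e nb s) (C : chosen 5 s) (S : selected n s) (F : full 5 s)
  (deg4 : forall v : 'I_n, arr s aMark v != 0 -> 4 <= #|e v|)
  (sAns : var s vAns = 0).

Lemma full_vertices : exists X : nat -> 'I_n, forall i, i < 5 ->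
  var s (vK i) = X i /\ arr s aMark (X i) = i.+1.
Proof.
have [x0 _ _] := F (isT : 0 < 5).
exists (fun i => insubd x0 (var s (vK i))) => i /F[v vE mE].
have -> : insubd x0 (var s (vK i)) = v by apply: val_inj; rewrite val_insubd vE ltn_ord.
by rewrite vE.
Qed.

(** The five marked vertices and the selected one have degree at least 5, so
    [top_clique] makes them a clique. *)
Lemma runs_six :
  5 < arr s aDeg (var s vB) ->
  runs (answer_no (rcons [seq Var (vK i) | i <- iota 0 5] (Var vB))) s 21 (certified e).
Proof.
move=> Db; have [X XP] := full_vertices.
have [b bE mb] := selected_unmarked C S (ltn_trans (isT : 0 < 5) Db).
have db : 5 <= #|e b| by rewrite -ltnS -(unmarked_deg C mb) -bE.
pose ws := rcons [seq X i | i <- iota 0 5] b.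
have sX i : i < 5 -> var s (vK i) = X i by move/XP=> [].
have mX i : i < 5 -> arr s aMark (X i) = i.+1 by move/XP=> [].
have memX (v : 'I_n) : arr s aMark v != 0 -> v \in ws.
  move=> /[dup] mv /(marked C)[m5 _ vE]; rewrite mem_rcons inE; apply/orP; right.
  have lt : (arr s aMark v).-1 < 5 by rewrite -ltnS prednK ?lt0n.
  apply/mapP; exists (arr s aMark v).-1; first by rewrite mem_iota.
  by apply: val_inj; rewrite /= -sX // vE.
have uws : uniq ws.
  rewrite rcons_uniq map_inj_in_uniq ?iota_uniq ?andbT.
    apply/mapP=> -[i]; rewrite mem_iota => /= i5 bX.
    by have := mX i i5; rewrite -bX mb.
  move=> i j; rewrite !mem_iota => /= /mX mi /mX mj E.
  by move: mi; rewrite E mj => -[].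
have wsP v : v \in ws -> v = b \/ arr s aMark v != 0.
  rewrite mem_rcons inE => /predU1P[->|/mapP[i]]; first by left.
  by rewrite mem_iota => /= /mX mi ->; right; rewrite mi.
have inW x : (x \in [set x in ws]) = (x \in ws) by rewrite in_set.
have clW : clique e [set x in ws].
  apply: top_clique => //.
    move=> x y; rewrite in_setC !inW => /wsP[->|mx] yW.
      have my : arr s aMark y = 0 by apply/eqP; apply: contraNT yW; apply: memX.
      rewrite -ltnS -(unmarked_deg C my) -(unmarked_deg C mb) -bE.
      by case: S.
    apply: (marked_top C _ mx); apply/eqP; apply: contraNT yW; exact: memX.
  move=> x; rewrite inW cardsE (card_uniqP uws) size_rcons size_map size_iota ltnS.
  case/wsP=> [-> //|mx]; apply: leq_trans db (marked_top C mb mx).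
pose es := rcons [seq Var (vK i) | i <- iota 0 5] (Var vB).
apply: (runs_weaken (t := (sumn [seq (ecost x).+2 | x <- es]).+1 + 2)
  (Q := certified e)) => //.
apply: (@runs_answer_no n e s _ _ (@complete 6) ws b) => //.
- by rewrite /ws /= bE !sX.
- move=> i j; have [<-|ij] := eqVneq i j; first by rewrite irr /complete eqxx.
  by rewrite /complete ij; apply: clW; rewrite ?inW ?mem_nth ?nth_uniq.
- by left.
Qed.

(** The marked vertices have degree at least 4 and the others at most 4, so
    [top_clique] and [top_independent] give the clique of size 5 and the independent
    set on which the decision tree relies.  An unmarked vertex with type 31 would
    have degree 5. *)
Lemma runs_five t :
  arr s aDeg (var s vB) <= 5 -> sound [::] [::] t ->
  (forall u, arr s aType u = 0) -> (forall u, arr s aRep u = 0) ->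
  runs (types ;; representatives ;; compile t) s (195 * n + 66 + dtree_cost t)
    (certified e).
Proof.
move=> Db st T0 R0; have [X XP] := full_vertices.
have [sn _ _ _] := Gs.
have sX i : i < 5 -> var s (vK i) = X i by move/XP=> [].
have mX i : i < 5 -> arr s aMark (X i) = i.+1 by move/XP=> [].
have Xm (v : 'I_n) : arr s aMark v != 0 ->
    arr s aMark v <= 5 /\ v = X (arr s aMark v).-1.
  move=> /[dup] mv /(marked C)[m5 _ vE]; split=> //; apply: val_inj.
  by rewrite /= -sX ?vE // -ltnS prednK ?lt0n.
pose A := [set v : 'I_n | arr s aMark v != 0].
have topA : top_set e A.
  by move=> x y; rewrite !inE negbK => mx /eqP my; apply: (marked_top C my mx).
have AE : A = [set X (val i) | i in 'I_5].
  apply/setP=> v; rewrite inE; apply/idP/imsetP => [/[dup] mv /Xm[m5 vE]|[i _ ->]].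
    have lt : (arr s aMark v).-1 < 5 by rewrite -ltnS prednK ?lt0n.
    by exists (Ordinal lt).
  by rewrite mX ?ltn_ord.
have XI : injective (fun i : 'I_5 => X i).
  move=> i j /= E; have := mX i (ltn_ord i).
  by rewrite E (mX j (ltn_ord j)) => -[/esym/val_inj].
have cA : #|A| = 5 by rewrite AE card_imset ?card_ord.
have clA : clique e A.
  by apply: top_clique => // v; rewrite inE cA => /deg4.
have deg_un (v : 'I_n) : arr s aMark v = 0 -> #|e v| < 5.
  move=> mv; rewrite -(unmarked_deg C mv).
  by case: S => _ /(_ v) h; apply: leq_trans h Db.
have indA : independent e (~: A).
  by apply: top_independent => // v; rewrite !inE negbK cA => /eqP/deg_un.
apply: (runs_weaken (Q := certified e)
  (t := 155 * n + 46 + (20 * n + 20 + (20 * n + dtree_cost t)))) => //; last by lia.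
apply: runs_seq (runs_types Gs sX T0) _ => s1 [fv1 fa1] T1.
have sn1 : var s1 vN = n by rewrite fv1.
have R1 m : arr s1 aRep m = 0 by rewrite fa1.
apply: runs_seq (runs_representatives sn1 R1) _ => s2 [fv2 fa2] [R2 R2'].
have M2 v : arr s2 aMark v = arr s aMark v by rewrite fa2 ?fa1.
have M1 v : arr s1 aMark v = arr s aMark v by rewrite fa1.
apply: (@runs_compile n e X s2 sym irr _ _ _ _ _ _ _ _ _ _ _ t [::] [::]) => //.
- by rewrite fv2.
- by rewrite fv2 ?fv1.
- by move=> i i5; rewrite fv2 ?fv1 ?sX.
- by move=> i i5; rewrite M2 mX.
- by move=> v; rewrite M2 => /Xm.
- move=> i j i5 j5 ij; apply: clA; rewrite ?inE ?mX //.
  by apply: contra ij => /eqP E; have := mX i i5; rewrite E (mX j j5) => -[->].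
- by move=> u v; rewrite !M2 => mu mv; apply: indA; rewrite !inE ?mu ?mv.
- move=> v; rewrite M2 => mv.
  have [/existsP[i iN]|] := boolP [exists i : 'I_5, ~~ e (X i) v]; first by exists i.
  move=> /existsPn all; have := deg_un v mv.
  rewrite ltnNge -cA => /negP[]; apply/subset_leq_card; rewrite AE.
  by apply/subsetP=> _ /imsetP[i _ ->]; have := all i; rewrite negbK -topredE /= sym.
- by move=> v _; rewrite fa2.
- move=> m /R2[v [rE mv tv]]; exists v; split=> //; first by rewrite M2 -M1.
  by rewrite fa2.
- by move=> v; rewrite M2 -M1 => /R2'; rewrite (fa2 aType).
Qed.

End Five.

Lemma runs_decide t :
  sound [::] [::] t ->
  runs (decide t) (input nb) ((1000 + dtree_cost t) * (n + edge_count e + 1))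
    (certified e).
Proof.
move=> st.
have G0 := graph_in_input sym irr adj.
(* The times of the last test and of its second branch, which dominates, then of
   the branches of the first test. *)
pose t2 := (4 + (195 * n + 66 + dtree_cost t)).+1.
pose t1 := maxn (20 * n + 116) (8 + (15 * n + 8 + t2)).
apply: (runs_weaken (Q := certified e) (t := 20 * n + 28 * edge_count e + 20 +
  (60 * n + 65 + (15 * n + 8 + (4 + t1).+1)))) => //; last by rewrite /t1 /t2; lia.
apply: runs_seq (runs_degrees G0 _) _ => // s1 f1 [D1 D1n].
have G1 : graph_in e nb s1 by apply: graph_in_frame f1 G0.
have [n1 _ _ _] := G1; have [fv1 fa1] := f1.
have M1 v : arr s1 aMark v = 0 by rewrite fa1.
have C1 : chosen 0 s1.
  split=> //; last exact: D1n.
  - by move=> v; rewrite M1.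
  - by move=> u v; rewrite !M1.
apply: runs_seq (runs_choose4 n1 C1) _ => s2 f2 C2.
have G2 : graph_in e nb s2 by apply: graph_in_frame f2 G1.
have [n2 _ _ _] := G2; have [fv2 fa2] := f2.
apply: runs_seq (runs_select_chosen n2 C2) _ => s3 f3 [C3 S3].
have G3 : graph_in e nb s3 by apply: graph_in_frame f3 G2.
have [n3 _ _ _] := G3; have [fv3 fa3] := f3.
have z3 a v : a \in [:: aType; aRep] -> arr s3 a v = 0.
  by rewrite !inE => /orP[]/eqP->; rewrite fa3 ?fa2 ?fa1.
have a3 : var s3 vAns = 0 by rewrite fv3 ?fv2 ?fv1.
apply: runs_if => /=.
  move=> lt; apply: runs_weaken (runs_few n3 C3 S3 _ _) _ _ => //; last exact: leq_maxl.
  - by case: ltnP lt.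
  - by move=> v; apply: z3.
move=> ge; have {}ge : 5 <= arr s3 aDeg (var s3 vB) by case: ltnP ge.
apply: (runs_weaken (t := 8 + (15 * n + 8 + t2)) (Q := certified e)) => //;
  last exact: leq_maxr.
apply: runs_seq (runs_take C3 S3) _ => s4 f4 [C4 few].
have [F4 d4] := few (ltn_trans (isT : 0 < 4) ge).
have G4 : graph_in e nb s4 by apply: graph_in_frame f4 G3.
have [n4 _ _ _] := G4; have [fv4 fa4] := f4.
apply: runs_seq (runs_select_chosen n4 C4) _ => s5 f5 [C5 S5].
have G5 : graph_in e nb s5 by apply: graph_in_frame f5 G4.
have [fv5 fa5] := f5.
have F5 : full 5 s5.
  by move=> k /F4[v vE mE]; exists v; rewrite ?fv5 ?fa5.
have d5 (v : 'I_n) : arr s5 aMark v != 0 -> 4 <= #|e v|.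
  by rewrite fa5 // => /d4 le; rewrite -ltnS (leq_trans ge le).
have z5 a v : a \in [:: aType; aRep] -> arr s5 a v = 0.
  by move=> aP; rewrite fa5 ?fa4 ?z3 //; move: aP; rewrite !inE => /orP[]/eqP->.
have a5 : var s5 vAns = 0 by rewrite fv5 ?fv4.
apply: runs_if => /=; case: ltnP => // Db _.
  by apply: runs_weaken (runs_six C5 S5 F5 a5 Db) _ _ => //; lia.
by apply: runs_five => // v; apply: z5.
Qed.

End Decide.

(** * A decision tree for the obstructions with five clique vertices *)

Definition mask (l : seq nat) : nat := sumn [seq 2 ^ i | i <- l].

Definition labelings : seq (seq nat) := permutations (iota 0 5).

(** The labelings of four tournaments on five vertices, given by their
    out-neighborhoods: a set of types that fits some tournament fits one of
    these. *)
Definition tournaments : seq (seq nat) :=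
  [seq [seq mask (map (nth 0 pi) (nth [::] outs (index c pi))) | c <- iota 0 5]
  | outs <- [::
      [:: [::]; [:: 0]; [:: 0; 1]; [:: 0; 1; 2]; [:: 0; 1; 2; 3]];
      [:: [:: 1; 2; 4]; [::]; [:: 1]; [:: 0; 1; 2]; [:: 1; 2; 3]];
      [:: [:: 4]; [:: 0; 3]; [:: 0; 1]; [:: 0; 2]; [:: 1; 2; 3]];
      [:: [:: 3; 4]; [:: 0; 4]; [:: 0; 1]; [:: 1; 2]; [:: 2; 3]]],
    pi <- labelings].

Definition tournament_covers : seq (seq nat * seq bool) :=
  [seq (o, [seq center o m < 5 | m <- iota 0 31]) | o <- tournaments].

Definition labeled_J : seq (seq (seq nat) * seq nat * seq nat) :=
  [seq (N, pi, [seq mask (map (nth 0 pi) l) | l <- N]) | N <- J_nbhds, pi <- labelings].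

(** Large types first: they fit the fewest tournaments. *)
Definition query_order : seq nat :=
  flatten [seq [seq m <- iota 0 31 | count (bit m) (iota 0 5) == k]
          | k <- [:: 4; 3; 2; 1]].

Section Search.
Variables (covers : seq (seq nat * seq bool))
  (obstructions : seq (seq (seq nat) * seq nat * seq nat)).

(** The search keeps a tournament that fits all types known to occur, and branches
    on a type that it does not fit and that is not known to be absent.  When no
    tournament is left, the types known to occur must contain an obstruction.  The
    depth is at most 31, as each query settles a new type; the leaves
    [Orient [::]] are unsound and so do not arise from sufficient fuel. *)
Fixpoint search (fuel : nat) (pres abs : seq nat) : dtree :=
  if fuel is fuel'.+1 then
    if [seq c <- covers | all (nth false c.2) pres] is (o, cov) :: _ then
      if [seq m <- query_order | ~~ nth false cov m && (m \notin abs)] is m :: _ then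
        Ask m (search fuel' (m :: pres) abs) (search fuel' pres (m :: abs))
      else Orient o
    else if [seq x <- obstructions | all (mem pres) x.2] is (N, pi, ms) :: _ then
      Obstruct N pi ms
    else Orient [::]
  else Orient [::].
End Search.

Definition decision_tree : dtree := search tournament_covers labeled_J 31 [::] [::].

(** The combinatorial heart of the characterization: a set of types that fits no
    tournament contains a relabeled copy of the independent vertices of some [J_i].
    It is established by evaluating the search, a case analysis with more than a
    thousand cases. *)
Lemma decision_tree_sound : sound [::] [::] decision_tree.
Proof. by vm_compute. Qed.

Theorem corollary3p13 :
  exists (p : cmd) (c : nat),
    forall (n : nat) (e : rel 'I_n) (nb : 'I_n -> seq 'I_n),
      symmetric e -> irreflexive e -> split_graph e -> adjacency_lists e nb ->
      exists (t : nat) (s : state),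
        exec p (input nb) t s /\
        t <= c * (n + edge_count e + 1) /\
        ((star_colorable e 5 /\ answers_yes s /\ yes_certificate e s) \/
         (~ star_colorable e 5 /\ answers_no s /\ no_certificate e s)).
Proof.
exists (decide decision_tree), (1000 + dtree_cost decision_tree).
move=> n e nb sym irr splitG adj.
have [t [s [run le cert]]] := runs_decide sym irr adj splitG decision_tree_sound.
exists t, s; split=> //; split=> //.
case: cert => [[yes cert]|[no cert]]; [left|right]; split=> //.
  by have [f [fS _]] := cert; exists f.
by have [W [_ ob]] := cert; apply: obstruction_not_colorable ob.
Qed.
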